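(* Let $K$ be a field and let $\mathcal{G}=(G^0,\mathcal{G}^1,r,s)$ be an ultragraph without sinks. Then there is an isomorphism of $\mathbb{Z}$-graded $K$-algebras $$L_K(\mathcal{G}\times_1\mathbb{Z})\cong L_K(\mathcal{G})\#\mathbb{Z}.$$
   Context: An ultragraph $\mathcal{G}=(G^0,\mathcal{G}^1,r,s)$ consists of a countable set $G^0$ of vertices, a countable set $\mathcal{G}^1$ of edges, and maps $s:\mathcal{G}^1\to G^0$, $r:\mathcal{G}^1\to\mathcal{P}(G^0)\setminus\{\varnothing\}$. A vertex $v$ is a sink if $s^{-1}(v)=\varnothing$, and regular if $0<|s^{-1}(v)|<\infty$. $\mathcal{G}^0$ is the smallest subset of $\mathcal{P}(G^0)$ containing all $\{v\}$ and all $r(e)$ and closed under finite unions and finite intersections. A finite path is either an element of $\mathcal{G}^0$ (length $0$) or a sequence $\alpha=e_1\cdots e_n$ of edges with $s(e_{i+1})\in r(e_i)$ (length $|\alpha|=n$); $\mathcal{G}^*$ is the set of finite paths. $L_K(\mathcal{G})$ is the $K$-algebra generated by $\{s_e,s_e^*: e\in\mathcal{G}^1\}\cup\{p_A: A\in\mathcal{G}^0\}$ subject to, for all $A,B\in\mathcal{G}^0$, $e,f\in\mathcal{G}^1$: (1) $p_\varnothing=0$, $p_Ap_B=p_{A\cap B}$, $p_{A\cup B}=p_A+p_B-p_{A\cap B}$; (2) $p_{s(e)}s_e=s_e=s_ep_{r(e)}$ and $p_{r(e)}s_e^*=s_e^*=s_e^*p_{s(e)}$; (3) $s_e^*s_f=\delta_{e,f}p_{r(e)}$;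 (4) $p_v=\sum_{s(e)=v}s_es_e^*$ for every regular vertex $v$ (with $p_v:=p_{\{v\}}$). Put $s_A:=s_A^*:=p_A$ for $A\in\mathcal G^0$, and $s_\alpha=s_{e_1}\cdots s_{e_n}$, $s_\alpha^*=s_{e_n}^*\cdots s_{e_1}^*$. It is $\mathbb{Z}$-graded with $L_K(\mathcal{G})_n=\mathrm{span}_K\{s_\alpha p_A s_\beta^*: \alpha,\beta\in\mathcal{G}^*, A\in\mathcal{G}^0, |\alpha|-|\beta|=n\}$. The skew product ultragraph $\mathcal{G}\times_1\mathbb{Z}$ has vertices $\{v_n: v\in G^0,n\in\mathbb{Z}\}$, edges $\{e_n: e\in\mathcal{G}^1,n\in\mathbb{Z}\}$, $s(e_n)=s(e)_n$ and $r(e_n)=r(e)_{n-1}:=\{w_{n-1}: w\in r(e)\}$. For a $\mathbb{Z}$-graded ring $A$ (possibly without unit), the smash product $A\#\mathbb{Z}$ is the set of all (finite) formal sums $\sum_{n\in\mathbb{Z}}r^{(n)}\mathsf{p}_n$ with $r^{(n)}\in A$ and symbols $\mathsf{p}_n$, with componentwise addition and multiplication extending linearly $(r\mathsf{p}_m)(s\mathsf{p}_n)=r\,s_{m-n}\,\mathsf{p}_n$, where $s_{m-n}$ is the degree $m-n$ component of $s$. It is $\mathbb{Z}$-graded with degree-$n$ component $\{\sum_k r^{(k)}\mathsf{p}_k: r^{(k)}\in A_n\}$. *)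

(* Defs.v *)
From HB Require Import structures.
From mathcomp Require Import all_boot all_order all_algebra finmap generic_quotient.
From mathcomp Require Import mathcomp_extra boolp classical_sets functions.
From mathcomp Require Import cardinality fsbigop.

Set Implicit Arguments.
Unset Strict Implicit.
Unset Printing Implicit Defensive.

Import GRing.Theory.
Local Open Scope classical_set_scope.
Local Open Scope ring_scope.
Local Open Scope quotient_scope.

Reserved Notation "x ** y" (at level 40, left associativity).

(* Associative K-algebras that need not have a unit. *)
HB.mixin Record Lmodule_isNAlgebra (K : fieldType) A of GRing.Lmodule K A := {
  nmul : A -> A -> A;
  nmulA : associative nmul;
  nmulDl : left_distributive nmul +%R;
  nmulDr : right_distributive nmul +%R;
  nmulZl : forall (c : K) (x y : A), nmul (c *: x) y = c *: nmul x y;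
  nmulZr : forall (c : K) (x y : A), nmul x (c *: y) = c *: nmul x y
}.

#[short(type="nalgType")]
HB.structure Definition NAlgebra (K : fieldType) :=
  {A of Lmodule_isNAlgebra K A & GRing.Lmodule K A}.

Notation "x ** y" := (nmul x y) : ring_scope.

(* Gradings by the integers: homog n is the homogeneous component of degree n,
   and the last axiom says that A is the direct sum of the homog n. *)
HB.mixin Record NAlgebra_isGraded (K : fieldType) A of NAlgebra K A := {
  homog : int -> set A;
  hom0 : forall n, homog n 0;
  homD : forall n x y, homog n x -> homog n y -> homog n (x + y);
  homZ : forall n (c : K) x, homog n x -> homog n (c *: x);
  homM : forall m n x y, homog m x -> homog n y -> homog (m + n) (x ** y);
  hom_direct : forall x : A, exists! f : int -> A,
    [/\ finite_set [set n | f n != 0], (forall n, homog n (f n))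
      & x = \sum_(n \in [set: int]) f n]
}.

#[short(type="gradedType")]
HB.structure Definition Graded (K : fieldType) :=
  {A of NAlgebra_isGraded K A & NAlgebra K A}.

Definition graded_iso (K : fieldType) (A B : gradedType K) (f : A -> B) : Prop :=
  [/\ linear f, {morph f : x y / x ** y}, bijective f
    & forall n, f @` (homog n) = homog n].

Section NAlgebraTheory.
Context {K : fieldType} {A : nalgType K}.
Implicit Types x y : A.

Lemma nmul0r x : 0 ** x = 0 :> A.
Proof. by rewrite -(scale0r x) nmulZl !scale0r. Qed.
Lemma nmulr0 x : x ** 0 = 0 :> A.
Proof. by rewrite -(scale0r x) nmulZr !scale0r. Qed.
Lemma nmulNr x y : (- x) ** y = - (x ** y).
Proof. by rewrite -scaleN1r nmulZl scaleN1r. Qed.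
Lemma nmulrN x y : x ** (- y) = - (x ** y).
Proof. by rewrite -scaleN1r nmulZr scaleN1r. Qed.
Lemma nmulBr x y z : x ** (y - z) = x ** y - x ** z.
Proof. by rewrite nmulDr nmulrN. Qed.
Lemma nmul_suml I (s : seq I) (F : I -> A) x :
  (\sum_(i <- s) F i) ** x = \sum_(i <- s) F i ** x.
Proof.
by elim: s => [|i s IH]; rewrite ?big_nil ?nmul0r // !big_cons nmulDl IH.
Qed.
Lemma nmul_sumr I (s : seq I) (F : I -> A) x :
  x ** (\sum_(i <- s) F i) = \sum_(i <- s) x ** F i.
Proof.
by elim: s => [|i s IH]; rewrite ?big_nil ?nmulr0 // !big_cons nmulDr IH.
Qed.
End NAlgebraTheory.

(* Algebras given by generators and relations, without unit. *)
Inductive nterm (K X : Type) :=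
| TGen of X
| TZero
| TAdd of nterm K X & nterm K X
| TOpp of nterm K X
| TScale of K & nterm K X
| TMul of nterm K X & nterm K X.
Arguments TGen {K X}.
Arguments TZero {K X}.

HB.instance Definition _ K X := gen_eqMixin (nterm K X).
HB.instance Definition _ K X := gen_choiceMixin (nterm K X).

(* The least congruence containing R and the axioms of K-algebras. *)
Inductive tcong (K : fieldType) X (R : nterm K X -> nterm K X -> Prop) :
  nterm K X -> nterm K X -> Prop :=
| tc_rel a b : R a b -> tcong R a b
| tc_refl a : tcong R a a
| tc_sym a b : tcong R a b -> tcong R b a
| tc_trans a b c : tcong R a b -> tcong R b c -> tcong R a c
| tc_add a a' b b' : tcong R a a' -> tcong R b b' -> tcong R (TAdd a b) (TAdd a' b')
| tc_opp a a' : tcong R a a' -> tcong R (TOpp a) (TOpp a')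
| tc_scale c a a' : tcong R a a' -> tcong R (TScale c a) (TScale c a')
| tc_mul a a' b b' : tcong R a a' -> tcong R b b' -> tcong R (TMul a b) (TMul a' b')
| tc_addA a b c : tcong R (TAdd a (TAdd b c)) (TAdd (TAdd a b) c)
| tc_addC a b : tcong R (TAdd a b) (TAdd b a)
| tc_add0 a : tcong R (TAdd TZero a) a
| tc_addN a : tcong R (TAdd (TOpp a) a) TZero
| tc_scaleA c d a : tcong R (TScale c (TScale d a)) (TScale (c * d) a)
| tc_scale1 a : tcong R (TScale 1 a) a
| tc_scaleDr c a b : tcong R (TScale c (TAdd a b)) (TAdd (TScale c a) (TScale c b))
| tc_scaleDl a c d : tcong R (TScale (c + d) a) (TAdd (TScale c a) (TScale d a))
| tc_mulA a b c : tcong R (TMul a (TMul b c)) (TMul (TMul a b) c)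
| tc_mulDl a b c : tcong R (TMul (TAdd a b) c) (TAdd (TMul a c) (TMul b c))
| tc_mulDr a b c : tcong R (TMul a (TAdd b c)) (TAdd (TMul a b) (TMul a c))
| tc_mulZl c a b : tcong R (TMul (TScale c a) b) (TScale c (TMul a b))
| tc_mulZr c a b : tcong R (TMul a (TScale c b)) (TScale c (TMul a b)).

Section Presented.
Context {K : fieldType} {X : Type}.
Variable R : nterm K X -> nterm K X -> Prop.

Definition tcongb (a b : nterm K X) : bool := `[< tcong R a b >].

Lemma tcongb_refl : reflexive tcongb.
Proof. by move=> a; apply/asboolP; exact: tc_refl. Qed.
Lemma tcongb_sym : symmetric tcongb.
Proof. by move=> a b; apply/asboolP/asboolP; exact: tc_sym. Qed.
Lemma tcongb_trans : transitive tcongb.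
Proof.
by move=> b a c /asboolP ab /asboolP bc; apply/asboolP; exact: tc_trans ab bc.
Qed.
Canonical tcong_equiv := EquivRel tcongb tcongb_refl tcongb_sym tcongb_trans.

Definition presented := {eq_quot tcong_equiv}.
HB.instance Definition _ := Choice.on presented.
HB.instance Definition _ := Quotient.on presented.

Definition pcls (t : nterm K X) : presented := \pi_presented t.

Lemma pclsP a b : pcls a = pcls b <-> tcong R a b.
Proof.
split=> [/eqquotP/asboolP //|ab]; by apply/eqquotP/asboolP.
Qed.

Lemma pcls_surj (x : presented) : exists t, x = pcls t.
Proof. by exists (repr x); rewrite /pcls reprK. Qed.

Lemma repr_pcls t : tcong R (repr (pcls t)) t.
Proof. by apply/pclsP; rewrite /pcls reprK. Qed.

Definition padd (x y : presented) := pcls (TAdd (repr x) (repr y)).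
Definition popp (x : presented) := pcls (TOpp (repr x)).
Definition pscale (c : K) (x : presented) := pcls (TScale c (repr x)).
Definition pmul (x y : presented) := pcls (TMul (repr x) (repr y)).

Lemma paddE a b : padd (pcls a) (pcls b) = pcls (TAdd a b).
Proof. by apply/pclsP/tc_add; exact: repr_pcls. Qed.
Lemma poppE a : popp (pcls a) = pcls (TOpp a).
Proof. by apply/pclsP/tc_opp; exact: repr_pcls. Qed.
Lemma pscaleE c a : pscale c (pcls a) = pcls (TScale c a).
Proof. by apply/pclsP/tc_scale; exact: repr_pcls. Qed.
Lemma pmulE a b : pmul (pcls a) (pcls b) = pcls (TMul a b).
Proof. by apply/pclsP/tc_mul; exact: repr_pcls. Qed.

Lemma paddA : associative padd.
Proof.
move=> x y z; have [[a ->] [b ->] [c ->]] := And3 (pcls_surj x) (pcls_surj y) (pcls_surj z).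
by rewrite !paddE; apply/pclsP; exact: tc_addA.
Qed.
Lemma paddC : commutative padd.
Proof.
move=> x y; have [[a ->] [b ->]] := conj (pcls_surj x) (pcls_surj y).
by rewrite !paddE; apply/pclsP; exact: tc_addC.
Qed.
Lemma padd0 : left_id (pcls TZero) padd.
Proof.
by move=> x; have [a ->] := pcls_surj x; rewrite paddE; apply/pclsP; exact: tc_add0.
Qed.
Lemma paddN : left_inverse (pcls TZero) popp padd.
Proof.
move=> x; have [a ->] := pcls_surj x.
by rewrite poppE paddE; apply/pclsP; exact: tc_addN.
Qed.
HB.instance Definition _ := GRing.isZmodule.Build presented paddA paddC padd0 paddN.

Lemma pclsD a b : pcls (TAdd a b) = pcls a + pcls b.
Proof. by rewrite -paddE. Qed.
Lemma pclsN a : pcls (TOpp a) = - pcls a.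
Proof. by rewrite -poppE. Qed.
Lemma pcls0 : pcls TZero = 0.
Proof. by []. Qed.

Lemma pscaleA c d x : pscale c (pscale d x) = pscale (c * d) x.
Proof. by have [a ->] := pcls_surj x; rewrite !pscaleE; apply/pclsP; exact: tc_scaleA. Qed.
Lemma pscale1 : left_id 1 pscale.
Proof.
by move=> x; have [a ->] := pcls_surj x; rewrite !pscaleE; apply/pclsP; exact: tc_scale1.
Qed.
Lemma pscaleDr : right_distributive pscale +%R.
Proof.
move=> c x y; have [[a ->] [b ->]] := conj (pcls_surj x) (pcls_surj y).
by rewrite -pclsD !pscaleE -pclsD; apply/pclsP; exact: tc_scaleDr.
Qed.
Lemma pscaleDl x : {morph pscale^~ x : c d / c + d}.
Proof.
move=> c d; have [a ->] := pcls_surj x.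
by rewrite !pscaleE -pclsD; apply/pclsP; exact: tc_scaleDl.
Qed.
HB.instance Definition _ := GRing.Zmodule_isLmodule.Build K presented
  pscaleA pscale1 pscaleDr pscaleDl.

Lemma pclsZ c a : pcls (TScale c a) = c *: pcls a.
Proof. by rewrite -pscaleE. Qed.

Lemma pmulA : associative pmul.
Proof.
move=> x y z; have [[a ->] [b ->] [c ->]] := And3 (pcls_surj x) (pcls_surj y) (pcls_surj z).
by rewrite !pmulE; apply/pclsP; exact: tc_mulA.
Qed.
Lemma pmulDl : left_distributive pmul +%R.
Proof.
move=> x y z; have [[a ->] [b ->] [c ->]] := And3 (pcls_surj x) (pcls_surj y) (pcls_surj z).
by rewrite -pclsD !pmulE -pclsD; apply/pclsP; exact: tc_mulDl.
Qed.
Lemma pmulDr : right_distributive pmul +%R.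
Proof.
move=> x y z; have [[a ->] [b ->] [c ->]] := And3 (pcls_surj x) (pcls_surj y) (pcls_surj z).
by rewrite -pclsD !pmulE -pclsD; apply/pclsP; exact: tc_mulDr.
Qed.
Lemma pmulZl c x y : pmul (c *: x) y = c *: pmul x y.
Proof.
have [[a ->] [b ->]] := conj (pcls_surj x) (pcls_surj y).
by rewrite -pclsZ !pmulE -pclsZ; apply/pclsP; exact: tc_mulZl.
Qed.
Lemma pmulZr c x y : pmul x (c *: y) = c *: pmul x y.
Proof.
have [[a ->] [b ->]] := conj (pcls_surj x) (pcls_surj y).
by rewrite -pclsZ !pmulE -pclsZ; apply/pclsP; exact: tc_mulZr.
Qed.
HB.instance Definition _ := Lmodule_isNAlgebra.Build K presented
  pmulA pmulDl pmulDr pmulZl pmulZr.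

Lemma pclsM a b : pcls (TMul a b) = pcls a ** pcls b.
Proof. by rewrite -pmulE. Qed.

Lemma pcls_rel a b : R a b -> pcls a = pcls b.
Proof. by move=> ab; apply/pclsP; exact: tc_rel. Qed.
End Presented.

Lemma fsumE (V : zmodType) (f : int -> V) (s : seq int) :
  uniq s -> (forall n, f n != 0 -> n \in s) ->
  \sum_(n \in [set: int]) f n = \sum_(n <- s) f n.
Proof.
move=> us fs; rewrite fsbig_supp; apply: fsbig_fwiden => //.
- by move=> n [_ /= /eqP]; exact: fs.
- by move=> n [/= _ /not_andP[//|/=]]; exact: contra_notP.
Qed.

Section DirectSum.
Context {K : fieldType} {V : lmodType K}.
Variable H : int -> set V.
Hypothesis H0 : forall n, H n 0.
Hypothesis HD : forall n x y, H n x -> H n y -> H n (x + y).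
Hypothesis HZ : forall n (c : K) x, H n x -> H n (c *: x).
Hypothesis Hspan : forall x, exists s : seq (int * V),
  (forall c, c \in s -> H c.1 c.2) /\ x = \sum_(c <- s) c.2.
Hypothesis Hindep : forall (s : seq int) (f : int -> V), uniq s ->
  (forall n, H n (f n)) -> \sum_(n <- s) f n = 0 -> forall n, n \in s -> f n = 0.

Lemma direct_sumP x : exists! f : int -> V,
  [/\ finite_set [set n | f n != 0], (forall n, H n (f n))
    & x = \sum_(n \in [set: int]) f n].
Proof.
have [s [sH ->]] := Hspan x.
pose f n : V := \sum_(c <- s | c.1 == n) c.2.
pose t := undup (map fst s).
have ft n : f n != 0 -> n \in t.
  apply: contraR; rewrite mem_undup => ns; rewrite /f big_seq_cond big1 // => c.
  by case/andP=> cs /eqP cn; move: ns; rewrite -cn map_f.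
exists f; split.
  split.
  - by apply: sub_finite_set (finite_seq t) => n; exact: ft.
  - move=> n; rewrite /f big_seq_cond; elim/big_ind: _ => //; first exact: HD.
    by move=> c /andP[cs /eqP <-]; exact: sH.
  - rewrite (@fsumE _ _ t) ?undup_uniq // /f.
    rewrite (exchange_big_dep xpredT) //= [LHS]big_seq [RHS]big_seq.
    apply: eq_bigr => c cs; rewrite -big_filter (eq_filter (a2 := pred1 c.1)).
      by rewrite filter_pred1_uniq ?undup_uniq ?mem_undup ?map_f // big_seq1.
    by move=> n; rewrite /= eq_sym.
move=> g [gfin gH gsum]; apply/funext => n.
pose u := undup (t ++ fset_set [set n | g n != 0]).
have uu : uniq u by exact: undup_uniq.
have fu m : f m != 0 -> m \in u by move=> /ft mt; rewrite mem_undup mem_cat mt.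
have gu m : g m != 0 -> m \in u.
  move=> gm; rewrite mem_undup mem_cat; apply/orP; right.
  by rewrite in_fset_set //; exact: mem_set.
have [nu|] := boolP (n \in u); last first.
  move=> nu; rewrite (_ : f n = 0); last by apply/eqP; apply: contraNT nu; exact: fu.
  by apply/esym/eqP; apply: contraNT nu; exact: gu.
apply/eqP; rewrite -subr_eq0; apply/eqP.
apply: (Hindep (f := f \- g)) nu => //.
  move=> m /=; apply: HD; last by rewrite -scaleN1r; apply: HZ; exact: gH.
  rewrite /f big_seq_cond; elim/big_ind: _ => //; first exact: HD.
  by move=> c /andP[cs /eqP <-]; exact: sH.
rewrite /= sumrB -(fsumE uu fu) -(fsumE uu gu) -gsum.
rewrite (@fsumE _ _ t) ?undup_uniq // /f.
rewrite (exchange_big_dep xpredT) //= [X in X - _]big_seq [X in _ - X]big_seq.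
apply/eqP; rewrite subr_eq0; apply/eqP.
apply: eq_bigr => c cs; rewrite -big_filter (eq_filter (a2 := pred1 c.1)).
  by rewrite filter_pred1_uniq ?undup_uniq ?mem_undup ?map_f // big_seq1.
by move=> m; rewrite /= eq_sym.
Qed.
End DirectSum.

Section Components.
Context {K : fieldType} {A : gradedType K}.
Implicit Types x y : A.

Definition hcomp (n : int) (x : A) : A := projT1 (cid (hom_direct x)) n.

Lemma hcomp_spec x : [/\ finite_set [set n | hcomp n x != 0],
  (forall n, homog n (hcomp n x)) & x = \sum_(n \in [set: int]) hcomp n x].
Proof. by rewrite /hcomp; case: cid => f []. Qed.

Lemma hcomp_hom n x : homog n (hcomp n x).
Proof. by have [] := hcomp_spec x. Qed.

Definition hsupp x : seq int := fset_set [set n | hcomp n x != 0].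

Lemma hsuppP n x : hcomp n x != 0 -> n \in hsupp x.
Proof. by move=> nx; have [fx _ _] := hcomp_spec x; rewrite in_fset_set //; exact: mem_set. Qed.

Lemma hcomp_sum x (s : seq int) : uniq s -> {subset hsupp x <= s} ->
  x = \sum_(n <- s) hcomp n x.
Proof.
move=> us xs; have [_ _ {1}->] := hcomp_spec x.
by apply: fsumE => // n /hsuppP; exact: xs.
Qed.

Lemma hcompP x (s : seq int) (f : int -> A) : uniq s -> (forall n, homog n (f n)) ->
  (forall n, f n != 0 -> n \in s) -> x = \sum_(n <- s) f n ->
  forall n, hcomp n x = f n.
Proof.
move=> us fH fs xE n; rewrite /hcomp; case: cid => /= g [_ gu].
rewrite (gu f) //; split=> //; last by rewrite (fsumE us).
exact: sub_finite_set (finite_seq s).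
Qed.

Lemma hcompD n x y : hcomp n (x + y) = hcomp n x + hcomp n y.
Proof.
pose s := undup (hsupp x ++ hsupp y).
apply: (@hcompP _ s (fun m => hcomp m x + hcomp m y)) => [|m|m|].
- exact: undup_uniq.
- by apply: homD; exact: hcomp_hom.
- rewrite mem_undup mem_cat; apply: contraR; rewrite negb_or => /andP[mx my].
  move/(contraNN (@hsuppP m x)): mx => /negPn/eqP->.
  by move/(contraNN (@hsuppP m y)): my => /negPn/eqP->; rewrite addr0.
- by rewrite big_split -!hcomp_sum ?undup_uniq // => m ms;
    rewrite mem_undup mem_cat ms ?orbT.
Qed.

Lemma hcompZ n c x : hcomp n (c *: x) = c *: hcomp n x.
Proof.
apply: (@hcompP _ (hsupp x) (fun m => c *: hcomp m x)) => [|m|m|].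
- exact: fset_uniq.
- by apply: homZ; exact: hcomp_hom.
- by apply: contraR => /(contraNN (@hsuppP m x))/negPn/eqP->; rewrite scaler0.
- by rewrite -scaler_sumr -hcomp_sum ?fset_uniq.
Qed.

Lemma hcomp0 n : hcomp n (0 : A) = 0.
Proof. by rewrite -(scale0r (0 : A)) hcompZ !scale0r. Qed.

Lemma hcomp_sumE n I (s : seq I) (F : I -> A) :
  hcomp n (\sum_(i <- s) F i) = \sum_(i <- s) hcomp n (F i).
Proof.
by elim: s => [|i s IH]; rewrite ?big_nil ?hcomp0 // !big_cons hcompD IH.
Qed.

Lemma hcomp_id m n x : homog m x -> hcomp n x = if n == m then x else 0.
Proof.
move=> xm; apply: (@hcompP _ [:: m] (fun n => if n == m then x else 0)) => //.
- by move=> {}n; case: eqP => [->|_] //; exact: hom0.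
- by move=> {}n; rewrite inE; case: (n == m) => //; rewrite eqxx.
- by rewrite big_seq1 eqxx.
Qed.

Lemma hcompMr m n x y : homog m y -> hcomp n (x ** y) = hcomp (n - m) x ** y.
Proof.
move=> ym; rewrite {1}(@hcomp_sum x (hsupp x)) ?fset_uniq // nmul_suml hcomp_sumE.
transitivity (\sum_(i <- hsupp x) (if i == n - m then hcomp i x ** y else 0)).
  apply: eq_bigr => i _; rewrite (hcomp_id _ (homM _ _ _ _ (hcomp_hom i x) ym)).
  by rewrite [i == _]eq_sym subr_eq.
rewrite -big_mkcond -big_filter /=.
have [ix|ix] := boolP (n - m \in hsupp x).
  by rewrite filter_pred1_uniq ?fset_uniq // big_seq1.
rewrite big_filter big_seq_cond big1 => [|i /andP[ii /eqP ie]].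
  by move/(contraNN (@hsuppP _ x)): ix => /negPn/eqP->; rewrite nmul0r.
by move: ix; rewrite -ie ii.
Qed.
End Components.

(* The smash product A # Z: formal sums \sum_n f n p_n are encoded by their
   finitely supported coefficient functions f. *)
Section SmashModule.
Context {K : fieldType} (A : gradedType K).

Definition finsuppf : {pred int -> A} := fun f => `[< finite_set [set n | f n != 0] >].

Lemma finsuppfP f (s : seq int) : (forall n, f n != 0 -> n \in s) -> f \in finsuppf.
Proof. by move=> fs; apply/asboolP; apply: sub_finite_set (finite_seq s). Qed.

Lemma finsuppf_supp f : f \in finsuppf ->
  exists2 s : seq int, uniq s & forall n, f n != 0 -> n \in s.
Proof.
move=> /asboolP ff; exists (fset_set [set n | f n != 0]); first exact: fset_uniq.
by move=> n fn; rewrite in_fset_set //; exact: mem_set.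
Qed.

Lemma finsuppf_submod : submod_closed finsuppf.
Proof.
split; first by apply: (@finsuppfP _ [::]) => n; rewrite eqxx.
move=> c f g /finsuppf_supp[s _ fs] /finsuppf_supp[t _ gt].
apply: (@finsuppfP _ (s ++ t)) => n; rewrite mem_cat; apply: contraR.
rewrite negb_or => /andP[/(contraNN (fs n))/negPn/eqP fn /(contraNN (gt n))/negPn/eqP gn].
have -> : (c *: f + g) n = c *: f n + g n by [].
by rewrite fn gn scaler0 addr0.
Qed.
HB.instance Definition _ := GRing.isSubmodClosed.Build K (int -> A) finsuppf
  finsuppf_submod.

Record smash := Smash { smash_fun :> int -> A; smash_funP : smash_fun \in finsuppf }.
HB.instance Definition _ := [isSub for smash_fun].
HB.instance Definition _ := [Choice of smash by <:].
HB.instance Definition _ := [SubChoice_isSubLmodule of smash by <:].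

Implicit Types f g h : smash.

Lemma smashP f g : (forall n, f n = g n) -> f = g.
Proof. by move=> fg; apply: val_inj; apply/funext. Qed.

Lemma smashDE f g n : (f + g) n = f n + g n. Proof. by []. Qed.
Lemma smashZE (c : K) f n : (c *: f) n = c *: f n. Proof. by []. Qed.
Lemma smash0E n : (0 : smash) n = 0. Proof. by []. Qed.
Lemma smash_sumE I (s : seq I) (F : I -> smash) n :
  (\sum_(i <- s) F i) n = \sum_(i <- s) F i n.
Proof. by elim: s => [|i s IH]; rewrite ?big_nil // !big_cons smashDE IH. Qed.

Lemma smash_supp f : exists2 s : seq int, uniq s & forall n, f n != 0 -> n \in s.
Proof. exact/finsuppf_supp/smash_funP. Qed.

(* (\sum_m f m p_m) (\sum_n g n p_n) = \sum_n (\sum_m f m (g n)_(m - n)) p_n *)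
Definition smash_mul_fun f g : int -> A :=
  fun n => \sum_(m \in [set: int]) f m ** hcomp (m - n) (g n).

Lemma smash_mul_funE f g n (s : seq int) : uniq s ->
  (forall m, f m != 0 -> m \in s) ->
  smash_mul_fun f g n = \sum_(m <- s) f m ** hcomp (m - n) (g n).
Proof.
move=> us fs; apply: fsumE => // m; apply: contraR => /(contraNN (fs m)).
by move=> /negPn/eqP->; rewrite nmul0r.
Qed.

Lemma smash_mul_funP f g : smash_mul_fun f g \in finsuppf.
Proof.
have [t _ gt] := smash_supp g; apply: (@finsuppfP _ t) => n.
have [s us fs] := smash_supp f; rewrite (smash_mul_funE g n us fs).
apply: contraR => /(contraNN (gt n))/negPn/eqP->.
by rewrite big1 // => m _; rewrite hcomp0 nmulr0.
Qed.

Definition smash_mul f g : smash := Smash (smash_mul_funP f g).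

Lemma smash_mulE f g n (s : seq int) : uniq s -> (forall m, f m != 0 -> m \in s) ->
  smash_mul f g n = \sum_(m <- s) f m ** hcomp (m - n) (g n).
Proof. exact: smash_mul_funE. Qed.

Lemma smash_supp2 f g : exists2 s : seq int, uniq s &
  forall n, f n != 0 \/ g n != 0 -> n \in s.
Proof.
have [s _ fs] := smash_supp f; have [t _ gt] := smash_supp g.
exists (undup (s ++ t)); first exact: undup_uniq.
by move=> n [/fs|/gt] nst; rewrite mem_undup mem_cat nst ?orbT.
Qed.

Lemma smash_mulA : associative smash_mul.
Proof.
move=> f g h; apply: smashP => n.
have [s us fs] := smash_supp f; have [t ut gt] := smash_supp g.
have fgt m : smash_mul f g m != 0 -> m \in t.
  apply: contraR => /(contraNN (gt m))/negPn/eqP g0.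
  by rewrite (smash_mulE _ _ us fs) g0 big1 // => i _; rewrite hcomp0 nmulr0.
rewrite (smash_mulE _ _ us fs) (smash_mulE _ _ ut fgt).
under eq_bigr => k _.
  rewrite (smash_mulE _ _ ut gt) hcomp_sumE nmul_sumr.
  under eq_bigr => m _.
    rewrite (hcompMr _ _ (hcomp_hom _ _)) opprB addrA subrK nmulA.
    over.
  over.
rewrite exchange_big; apply: eq_bigr => m _.
by rewrite (smash_mulE _ _ us fs) nmul_suml.
Qed.

Lemma smash_mulDl : left_distributive smash_mul +%R.
Proof.
move=> f g h; apply: smashP => n; have [s us fgs] := smash_supp2 f g.
have fs m : f m != 0 -> m \in s by move=> fm; apply: fgs; left.
have gs m : g m != 0 -> m \in s by move=> fm; apply: fgs; right.
have fgs' m : (f + g) m != 0 -> m \in s.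
  apply: contraR => ms; rewrite smashDE.
  move/(contraNN (fs m)): (ms) => /negPn/eqP->.
  by move/(contraNN (gs m)): (ms) => /negPn/eqP->; rewrite addr0.
rewrite smashDE !(smash_mulE _ _ us) // -big_split.
by apply: eq_bigr => m _; rewrite smashDE nmulDl.
Qed.

Lemma smash_mulDr : right_distributive smash_mul +%R.
Proof.
move=> f g h; apply: smashP => n; have [s us fs] := smash_supp f.
rewrite smashDE !(smash_mulE _ _ us fs) -big_split.
by apply: eq_bigr => m _; rewrite smashDE hcompD nmulDr.
Qed.

Lemma smash_mulZl c f g : smash_mul (c *: f) g = c *: smash_mul f g.
Proof.
apply: smashP => n; have [s us fs] := smash_supp f.
have cfs m : (c *: f) m != 0 -> m \in s.
  by apply: contraR => /(contraNN (fs m))/negPn/eqP f0; rewrite smashZE f0 scaler0.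
rewrite smashZE !(smash_mulE _ _ us) // scaler_sumr.
by apply: eq_bigr => m _; rewrite smashZE nmulZl.
Qed.

Lemma smash_mulZr c f g : smash_mul f (c *: g) = c *: smash_mul f g.
Proof.
apply: smashP => n; have [s us fs] := smash_supp f.
rewrite smashZE !(smash_mulE _ _ us) // scaler_sumr.
by apply: eq_bigr => m _; rewrite smashZE hcompZ nmulZr.
Qed.

HB.instance Definition _ := Lmodule_isNAlgebra.Build K smash
  smash_mulA smash_mulDl smash_mulDr smash_mulZl smash_mulZr.

Definition smash_hom (n : int) : set smash := [set f | forall k, homog n (f k)].

Lemma smash_hom0 n : smash_hom n 0.
Proof. by move=> k; exact: hom0. Qed.
Lemma smash_homD n f g : smash_hom n f -> smash_hom n g -> smash_hom n (f + g).
Proof. by move=> fn gn k; apply: homD. Qed.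
Lemma smash_homZ n (c : K) f : smash_hom n f -> smash_hom n (c *: f).
Proof. by move=> fn k; apply: homZ. Qed.
Lemma smash_homM m n f g : smash_hom m f -> smash_hom n g -> smash_hom (m + n) (f ** g).
Proof.
move=> fm gn k; have [s us fs] := smash_supp f.
rewrite (smash_mulE _ _ us fs); elim/big_ind: _ => [||i _].
- exact: hom0.
- exact: homD.
- by apply: homM => //; rewrite (hcomp_id _ (gn k)); case: ifP => // _; exact: hom0.
Qed.

Lemma smash_hom_span f : exists s : seq (int * smash),
  (forall c, c \in s -> smash_hom c.1 c.2) /\ f = \sum_(c <- s) c.2.
Proof.
have [t ut ft] := smash_supp f.
have fin n : (fun k => hcomp n (f k)) \in finsuppf.
  apply: (@finsuppfP _ t) => k; apply: contraR => /(contraNN (ft k))/negPn/eqP->.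
  exact/eqP/hcomp0.
pose u := undup (flatten [seq (hsupp (f k) : seq int) | k <- t]).
exists [seq (n, Smash (fin n)) | n <- u]; split.
  by move=> _ /mapP[n _ ->] k; exact: hcomp_hom.
apply: smashP => k; rewrite big_map smash_sumE /=.
have [kt|/(contraNN (ft k))/negPn/eqP->] := boolP (k \in t); last first.
  by rewrite big1 // => i _; exact: hcomp0.
apply: hcomp_sum; first exact: undup_uniq.
by move=> n nk; rewrite mem_undup; apply/flattenP; exists (hsupp (f k)) => //; exact: map_f.
Qed.

Lemma smash_hom_indep (s : seq int) (F : int -> smash) : uniq s ->
  (forall n, smash_hom n (F n)) -> \sum_(n <- s) F n = 0 ->
  forall n, n \in s -> F n = 0.
Proof.
move=> us FH F0 n ns; apply: smashP => k.
have /(congr1 (hcomp n)) : \sum_(m <- s) F m k = 0 by rewrite -smash_sumE F0.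
rewrite hcomp0 hcomp_sumE smash0E => <-.
rewrite (bigD1_seq n) //= (hcomp_id _ (FH n k)) eqxx big1 ?addr0 // => i ine.
by rewrite (hcomp_id _ (FH i k)) eq_sym (negbTE ine).
Qed.

HB.instance Definition _ := NAlgebra_isGraded.Build K smash
  smash_hom0 smash_homD smash_homZ smash_homM
  (direct_sumP smash_hom0 smash_homD smash_homZ smash_hom_span smash_hom_indep).

(* The formal sum r p_n with one term. *)
Lemma smash_term_subproof (r : A) n : (fun k => if k == n then r else 0) \in finsuppf.
Proof.
by apply: (@finsuppfP _ [:: n]) => k; rewrite inE; case: ifP => //; rewrite eqxx.
Qed.
Definition smash_term r n : smash := Smash (smash_term_subproof r n).

Lemma smash_termM r m s n :
  smash_term r m ** smash_term s n = smash_term (r ** hcomp (m - n) s) n.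
Proof.
apply: smashP => k; rewrite (@smash_mulE _ _ _ [:: m]) //; last first.
  by move=> i /=; rewrite inE; case: ifP => //; rewrite eqxx.
by rewrite big_seq1 /= eqxx; case: eqP => [->//|_]; rewrite hcomp0 nmulr0.
Qed.
End SmashModule.

Record ultragraph := Ultragraph {
  vtx : countType;
  edge : countType;
  src : edge -> vtx;
  rng : edge -> set vtx;
  rng_neq0 : forall e, rng e !=set0
}.
Arguments src {u}.
Arguments rng {u}.

Definition sink (G : ultragraph) (v : vtx G) : Prop := src @^-1` [set v] = set0.

Definition regular (G : ultragraph) (v : vtx G) : Prop :=
  finite_set (src @^-1` [set v]) /\ src @^-1` [set v] !=set0.

(* The family of sets of vertices usually written as a calligraphic G^0; the
   empty set, being the empty union, belongs to it. *)
Inductive gen_vtx (G : ultragraph) : set (vtx G) -> Prop :=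
| gv_set0 : gen_vtx set0
| gv_set1 v : gen_vtx [set v]
| gv_rng e : gen_vtx (rng e)
| gv_setU A B : gen_vtx A -> gen_vtx B -> gen_vtx (A `|` B)
| gv_setI A B : gen_vtx A -> gen_vtx B -> gen_vtx (A `&` B).
Arguments gen_vtx : clear implicits.

Definition gvtx (G : ultragraph) := {A : set (vtx G) | gen_vtx G A}.

Section GVtx.
Context {G : ultragraph}.
Definition gvtx0 : gvtx G := exist _ set0 (gv_set0 G).
Definition gvtx1 (v : vtx G) : gvtx G := exist _ [set v] (gv_set1 v).
Definition gvtxr (e : edge G) : gvtx G := exist _ (rng e) (gv_rng e).
Definition gvtxU (A B : gvtx G) : gvtx G :=
  exist _ (sval A `|` sval B) (gv_setU (svalP A) (svalP B)).
Definition gvtxI (A B : gvtx G) : gvtx G :=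
  exist _ (sval A `&` sval B) (gv_setI (svalP A) (svalP B)).

Lemma gvtxP (A B : gvtx G) : sval A = sval B -> A = B.
Proof. exact: eq_sig_hprop (fun _ => @Prop_irrelevance _) A B. Qed.
End GVtx.

(* The generators p_A, s_e and s_e^*. *)
Inductive lgen (G : ultragraph) :=
| Lp of gvtx G
| Ls of edge G
| Lss of edge G.

Section LeavittRelations.
Variables (K : fieldType) (G : ultragraph).

Local Notation p A := (TGen (Lp A)).
Local Notation s e := (TGen (Ls e)).
Local Notation "s^* e" := (TGen (Lss e)) (at level 10, e at level 8).

Inductive lrel : nterm K (lgen G) -> nterm K (lgen G) -> Prop :=
| lrel_p0 : lrel (p gvtx0) TZero
| lrel_pI A B : lrel (TMul (p A) (p B)) (p (gvtxI A B))
| lrel_pU A B :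
    lrel (p (gvtxU A B)) (TAdd (TAdd (p A) (p B)) (TOpp (p (gvtxI A B))))
| lrel_ps e : lrel (TMul (p (gvtx1 (src e))) (s e)) (s e)
| lrel_sp e : lrel (TMul (s e) (p (gvtxr e))) (s e)
| lrel_pss e : lrel (TMul (p (gvtxr e)) (s^* e)) (s^* e)
| lrel_ssp e : lrel (TMul (s^* e) (p (gvtx1 (src e)))) (s^* e)
| lrel_sss e f : lrel (TMul (s^* e) (s f)) (if e == f then p (gvtxr e) else TZero)
| lrel_reg v : regular v ->
    lrel (p (gvtx1 v))
         (\big[@TAdd _ _/TZero]_(e <- fset_set (src @^-1` [set v])) TMul (s e) (s^* e)).

End LeavittRelations.

Section Leavitt.
Variables (K : fieldType) (G : ultragraph).
Local Notation lrel := (@lrel K G).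

Definition leavitt := presented lrel.
HB.instance Definition _ := NAlgebra.on leavitt.

Definition lcls (t : nterm K (lgen G)) : leavitt := pcls lrel t.

Lemma lcls_rel a b : lrel a b -> lcls a = lcls b.
Proof. exact: pcls_rel. Qed.
Lemma lcls_surj x : exists t, x = lcls t.
Proof. exact: pcls_surj. Qed.
Lemma lcls0 : lcls TZero = 0.
Proof. by []. Qed.
Lemma lclsD a b : lcls (TAdd a b) = lcls a + lcls b.
Proof. exact: pclsD. Qed.
Lemma lclsN a : lcls (TOpp a) = - lcls a.
Proof. exact: pclsN. Qed.
Lemma lclsZ c a : lcls (TScale c a) = c *: lcls a.
Proof. exact: pclsZ. Qed.
Lemma lclsM a b : lcls (TMul a b) = lcls a ** lcls b.
Proof. exact: pclsM. Qed.

Definition lp (A : gvtx G) : leavitt := lcls (TGen (Lp A)).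
Definition ls (e : edge G) : leavitt := lcls (TGen (Ls e)).
Definition lss (e : edge G) : leavitt := lcls (TGen (Lss e)).

Lemma lp0 : lp gvtx0 = 0.
Proof. exact: lcls_rel (lrel_p0 K G). Qed.
Lemma lpM A B : lp A ** lp B = lp (gvtxI A B).
Proof. by rewrite -[LHS]lclsM; exact: lcls_rel (lrel_pI K A B). Qed.
Lemma lpU A B : lp (gvtxU A B) = lp A + lp B - lp (gvtxI A B).
Proof.
by rewrite /lp -lclsN -!lclsD; exact: lcls_rel (lrel_pU K A B).
Qed.
Lemma lp_ls e : lp (gvtx1 (src e)) ** ls e = ls e.
Proof. by rewrite -[LHS]lclsM; exact: lcls_rel (lrel_ps K e). Qed.
Lemma ls_lp e : ls e ** lp (gvtxr e) = ls e.
Proof. by rewrite -[LHS]lclsM; exact: lcls_rel (lrel_sp K e). Qed.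
Lemma lp_lss e : lp (gvtxr e) ** lss e = lss e.
Proof. by rewrite -[LHS]lclsM; exact: lcls_rel (lrel_pss K e). Qed.
Lemma lss_lp e : lss e ** lp (gvtx1 (src e)) = lss e.
Proof. by rewrite -[LHS]lclsM; exact: lcls_rel (lrel_ssp K e). Qed.
Lemma lss_ls e f : lss e ** ls f = if e == f then lp (gvtxr e) else 0.
Proof.
by rewrite -[LHS]lclsM (lcls_rel (lrel_sss K e f)); case: eqP.
Qed.

Lemma lcls_sum I (r : seq I) (F : I -> nterm K (lgen G)) :
  lcls (\big[@TAdd _ _/TZero]_(i <- r) F i) = \sum_(i <- r) lcls (F i).
Proof.
elim: r => [|i r IH]; first by rewrite !big_nil.
by rewrite !big_cons -IH; exact: lclsD.
Qed.

Lemma lp_reg v : regular v ->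
  lp (gvtx1 v) = \sum_(e <- fset_set (src @^-1` [set v])) ls e ** lss e.
Proof.
move=> rv; rewrite [LHS](lcls_rel (lrel_reg K rv)) [LHS]lcls_sum.
by apply: eq_bigr => e _; exact: lclsM.
Qed.

Lemma leavitt_ind (P : leavitt -> Prop) :
  (forall A, P (lp A)) -> (forall e, P (ls e)) -> (forall e, P (lss e)) ->
  P 0 -> (forall x y, P x -> P y -> P (x + y)) ->
  (forall c x, P x -> P (c *: x)) -> (forall x y, P x -> P y -> P (x ** y)) ->
  forall x, P x.
Proof.
move=> Pp Ps Pss P0 PD PZ PM x; have [t ->] := lcls_surj x.
elim: t => [[A|e|e]||a IHa b IHb|a IHa|c a IHa|a IHa b IHb].
- exact: Pp.
- exact: Ps.
- exact: Pss.
- exact: P0.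
- by rewrite lclsD; exact: PD.
- by rewrite lclsN -scaleN1r; exact: PZ.
- by rewrite lclsZ; exact: PZ.
- by rewrite lclsM; exact: PM.
Qed.

Inductive fpath :=
| PSet of gvtx G
| PEdges (e : edge G) (es : seq (edge G)) of
    path (fun e f => src f \in rng e) e es.

Definition flen (a : fpath) : nat :=
  match a with PSet _ => 0 | PEdges _ es _ => (size es).+1 end.

Fixpoint ls_seq (e : edge G) (es : seq (edge G)) : leavitt :=
  if es is f :: es' then ls e ** ls_seq f es' else ls e.

Fixpoint lss_seq (e : edge G) (es : seq (edge G)) : leavitt :=
  if es is f :: es' then lss_seq f es' ** lss e else lss e.

Definition lpath (a : fpath) : leavitt :=
  match a with PSet A => lp A | PEdges e es _ => ls_seq e es end.

Definition lpaths (a : fpath) : leavitt :=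
  match a with PSet A => lp A | PEdges e es _ => lss_seq e es end.

Definition lmonom (n : int) : set leavitt :=
  [set x | exists a A b, (flen a)%:Z - (flen b)%:Z = n
                         /\ x = lpath a ** lp A ** lpaths b].

Definition lhom (n : int) : set leavitt :=
  [set x | exists2 r : seq (K * leavitt), (forall c, c \in r -> lmonom n c.2)
                                        & x = \sum_(c <- r) c.1 *: c.2].

Lemma lhom0 n : lhom n 0.
Proof. by exists [::]; [move=> c; rewrite in_nil|rewrite big_nil]. Qed.
Lemma lhomD n x y : lhom n x -> lhom n y -> lhom n (x + y).
Proof.
move=> [r rn ->] [t tn ->]; exists (r ++ t); last by rewrite big_cat.
by move=> c; rewrite mem_cat => /orP[/rn|/tn].
Qed.
Lemma lhomZ n (c : K) x : lhom n x -> lhom n (c *: x).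
Proof.
move=> [r rn ->]; exists [seq (c * d.1, d.2) | d <- r].
  by move=> _ /mapP[d dr ->]; exact: rn dr.
by rewrite big_map scaler_sumr; apply: eq_bigr => d _; rewrite scalerA.
Qed.
Lemma lhom_monom n x : lmonom n x -> lhom n x.
Proof.
move=> xn; exists [:: (1, x)]; last by rewrite big_seq1 scale1r.
by move=> c; rewrite inE => /eqP ->.
Qed.

Lemma lp1_ls e (A : gvtx G) :
  lp A ** ls e = if src e \in sval A then ls e else 0.
Proof.
rewrite -lp_ls nmulA lpM; case: ifPn => [eA|neA].
  congr (lp _ ** _); apply: gvtxP => /=; apply/seteqP; split=> [x []//|x -> /=].
  by split=> //; exact/set_mem.
rewrite (_ : gvtxI _ _ = gvtx0) ?lp0 ?nmul0r //.
apply: gvtxP => /=; apply/seteqP; split=> // x [/= Ax xe]; apply/negP: neA.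
by rewrite negbK -xe; exact: mem_set.
Qed.

Lemma lss_lp1 e (A : gvtx G) :
  lss e ** lp A = if src e \in sval A then lss e else 0.
Proof.
rewrite -lss_lp -nmulA lpM; case: ifPn => [eA|neA].
  congr (_ ** lp _); apply: gvtxP => /=; apply/seteqP; split=> [x []//|x -> /=].
  by split=> //; exact/set_mem.
rewrite (_ : gvtxI _ _ = gvtx0) ?lp0 ?nmulr0 //.
apply: gvtxP => /=; apply/seteqP; split=> // x [/= xe Ax]; apply/negP: neA.
by rewrite negbK -xe; exact: mem_set.
Qed.

Lemma lhom_lin (g : leavitt) (d n : int) :
  (forall x, lmonom n x -> lhom (d + n) (g ** x)) ->
  forall x, lhom n x -> lhom (d + n) (g ** x).
Proof.
move=> gx x [r rn ->]; rewrite nmul_sumr big_seq.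
elim/big_ind: _ => [||c cr]; [exact: lhom0|exact: lhomD|].
by rewrite nmulZr; apply/lhomZ/gx/rn.
Qed.

Lemma lp_ls_seq A e es :
  lp A ** ls_seq e es = if src e \in sval A then ls_seq e es else 0.
Proof.
by case: es => [|f es] /=; rewrite ?nmulA lp1_ls; case: ifP;
  rewrite ?nmul0r.
Qed.

Lemma lss_seq_lp A e es :
  lss_seq e es ** lp A = if src e \in sval A then lss_seq e es else 0.
Proof.
by case: es => [|f es] /=; rewrite -?nmulA lss_lp1; case: ifP; rewrite ?nmulr0.
Qed.

Lemma lhom_lp A n x : lhom n x -> lhom (0 + n) (lp A ** x).
Proof.
move: x; apply: lhom_lin => _ [a [B [b [<- ->]]]]; rewrite add0r.
rewrite !nmulA; case: a => [C|e es ees] /=.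
  by rewrite lpM; apply: lhom_monom; exists (PSet (gvtxI A C)), B, b.
rewrite lp_ls_seq; case: ifP => _; last by rewrite !nmul0r; exact: lhom0.
by apply: lhom_monom; exists (PEdges ees), B, b.
Qed.

Lemma lhom_ls e n x : lhom n x -> lhom (1 + n) (ls e ** x).
Proof.
move: x; apply: lhom_lin => _ [a [B [b [<- ->]]]].
rewrite !nmulA; case: a => [C|f es fes] /=.
  rewrite -[ls e ** _ ** _]nmulA lpM; apply: lhom_monom.
  by exists (@PEdges e [::] isT), (gvtxI C B), b; split; rewrite //= sub0r.
have [fe|fe] := boolP (src f \in rng e).
  have ees : path (fun e f => src f \in rng e) e (f :: es) by rewrite /= fe.
  apply: lhom_monom; exists (PEdges ees), B, b; split=> //=.
  by rewrite addrA -intS.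
rewrite -(ls_lp e) -[_ ** ls_seq _ _]nmulA lp_ls_seq /= (negbTE fe).
by rewrite nmulr0 !nmul0r; exact: lhom0.
Qed.

Lemma lss_seq_rcons e es f :
  lss_seq e (rcons es f) = lss f ** lss_seq e es.
Proof. by elim: es e => [|g es IH] e //=; rewrite IH nmulA. Qed.

Lemma lp_lss_seq e es : lp (gvtxr (last e es)) ** lss_seq e es = lss_seq e es.
Proof.
elim: es e => [|g es IH] e /=; first exact: lp_lss.
by rewrite nmulA IH.
Qed.

Lemma lss_lpaths e A b :
  lhom (- (flen b).+1%:Z) (lss e ** lp A ** lpaths b).
Proof.
rewrite lss_lp1; case: ifP => [eA|_]; last by rewrite nmul0r; exact: lhom0.
case: b => [B|f es fes] /=.
  rewrite lss_lp1; case: ifP => _; last exact: lhom0.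
  apply: lhom_monom; exists (PSet (gvtxr e)), (gvtxr e), (@PEdges e [::] isT).
  by split; rewrite ?sub0r //= lpM -lp_lss nmulA lpM; congr (lp _ ** _);
    apply: gvtxP; rewrite /= !setIid.
have [le|le] := boolP (src e \in rng (last f es)); last first.
  by rewrite -lp_lss_seq nmulA lss_lp1 /= (negbTE le) nmul0r; exact: lhom0.
have ees : path (fun e f => src f \in rng e) f (rcons es e).
  by rewrite rcons_path fes.
apply: lhom_monom; exists (PSet (gvtxr e)), (gvtxr e), (PEdges ees).
rewrite /= size_rcons sub0r lss_seq_rcons lpM; split=> //.
rewrite nmulA -[in LHS]lp_lss; congr (lp _ ** _ ** _).
by apply: gvtxP; rewrite /= setIid.
Qed.

Lemma lhom_lss e n x : lhom n x -> lhom (-1 + n) (lss e ** x).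
Proof.
move: x; apply: lhom_lin => _ [a [B [b [<- ->]]]].
rewrite !nmulA; case: a => [C|f es fes] /=.
  rewrite -[lss e ** _ ** _]nmulA lpM sub0r -opprD -intS; exact: lss_lpaths.
have lssE : lss e ** ls_seq f es =
    if e == f then (if es is g :: es' then lp (gvtxr e) ** ls_seq g es'
                    else lp (gvtxr e)) else 0.
  by case: es fes => [|g es] _ /=; rewrite ?nmulA lss_ls; case: eqP => // _;
    rewrite nmul0r.
rewrite lssE; case: eqP => _; last by rewrite !nmul0r; exact: lhom0.
rewrite intS addrA addKr.
case: es fes {lssE} => [|g es] /= => [_|/andP[_ ges]].
  by apply: lhom_monom; exists (PSet (gvtxr e)), B, b.
rewrite lp_ls_seq; case: ifP => _; last by rewrite !nmul0r; exact: lhom0.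
by apply: lhom_monom; exists (PEdges ges), B, b.
Qed.

Lemma lhomM m n x y : lhom m x -> lhom n y -> lhom (m + n) (x ** y).
Proof.
move=> [r rm ->] yn; rewrite nmul_suml big_seq.
elim/big_ind: _ => [||c /rm xm]; [exact: lhom0|exact: lhomD|].
rewrite nmulZl; apply: lhomZ; move: c.2 xm => _ [a [A [b [<- ->]]]] {c r rm x}.
have yb : lhom (- (flen b)%:Z + n) (lpaths b ** y).
  case: b => [B|e es _] /=; first by rewrite oppr0; exact: lhom_lp.
  elim: es e n y yn => [|f es IH] e n y yn /=; first exact: lhom_lss.
  rewrite -nmulA intS addrC opprD addrA [n - 1]addrC addrC.
  by apply: IH; exact: lhom_lss.
have yA : lhom (- (flen b)%:Z + n) (lp A ** (lpaths b ** y)).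
  by rewrite -[- _ + n]add0r; exact: lhom_lp.
rewrite -!nmulA -addrA; move: (_ + n) (_ ** _) yA => {yb y yn}n y yn.
case: a => [B|e es _] /=; first exact: lhom_lp.
elim: es e => [|f es IH] e /=; first exact: lhom_ls.
by rewrite -nmulA intS -addrA; apply/lhom_ls/IH.
Qed.

Lemma lhom_span x : exists s : seq (int * leavitt),
  (forall c, c \in s -> lhom c.1 c.2) /\ x = \sum_(c <- s) c.2.
Proof.
have one n y : lhom n y -> exists s : seq (int * leavitt),
    (forall c, c \in s -> lhom c.1 c.2) /\ y = \sum_(c <- s) c.2.
  move=> yn; exists [:: (n, y)]; split; last by rewrite big_seq1.
  by move=> c; rewrite inE => /eqP->.
have monp A : lhom 0 (lp A).
  apply: lhom_monom; exists (PSet A), A, (PSet A); split=> //=.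
  by rewrite !lpM; congr lp; apply: gvtxP; rewrite /= !setIid.
elim/leavitt_ind: x => [A|e|e||x y|c x|x y].
- exact: one (monp A).
- by rewrite -ls_lp; apply: (one _ _ (lhom_ls e (monp _))).
- by rewrite -lss_lp; apply: (one _ _ (lhom_lss e (monp _))).
- by exists [::]; rewrite big_nil.
- move=> [s [sH ->]] [t [tH ->]]; exists (s ++ t); rewrite big_cat; split=> // d.
  by rewrite mem_cat => /orP[/sH|/tH].
- move=> [s [sH ->]]; exists [seq (d.1, c *: d.2) | d <- s].
  rewrite big_map scaler_sumr; split=> // _ /mapP[d /sH ds ->]; exact: lhomZ.
- move=> [s [sH ->]] [t [tH ->]].
  exists [seq (d.1 + d'.1, d.2 ** d'.2) | d <- s, d' <- t]; split.
    by move=> _ /allpairsP[[d d'] /= [/sH ds /tH dt ->]]; exact: lhomM.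
  rewrite big_allpairs_dep nmul_suml; apply: eq_bigr => d _.
  by rewrite nmul_sumr.
Qed.

Lemma leavitt_unit x : exists A, x ** lp A = x.
Proof.
have sub z A B : z ** lp A = z -> z ** lp (gvtxU A B) = z /\ z ** lp (gvtxU B A) = z.
  move=> zA; split; rewrite -{1}zA -nmulA lpM -[RHS]zA; congr (_ ** lp _);
    apply: gvtxP => /=; apply/seteqP; split=> [v []//|v Av]; split=> //;
    by [left|right].
elim/leavitt_ind: x => [A|e|e||x y [A xA] [B yB]|c x [A xA]|x y _ [B yB]].
- by exists A; rewrite lpM; congr lp; apply: gvtxP; rewrite /= setIid.
- by exists (gvtxr e); exact: ls_lp.
- by exists (gvtx1 (src e)); exact: lss_lp.
- by exists gvtx0; rewrite nmul0r.
- exists (gvtxU A B); rewrite nmulDl.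
  by have [-> _] := sub _ _ B xA; have [_ ->] := sub _ _ A yB.
- by exists A; rewrite nmulZl xA.
- by exists B; rewrite -nmulA yB.
Qed.

(* Terms act on formal series \sum_n f n t^n, infinite in both directions, by
   s_e |-> s_e t and s_e^* |-> s_e^* t^-1; this separates the degrees. *)
Fixpoint lact (t : nterm K (lgen G)) (f : int -> leavitt) (n : int) : leavitt :=
  match t with
  | TGen (Lp A) => lp A ** f n
  | TGen (Ls e) => ls e ** f (n - 1)
  | TGen (Lss e) => lss e ** f (n + 1)
  | TZero => 0
  | TAdd a b => lact a f n + lact b f n
  | TOpp a => - lact a f n
  | TScale c a => c *: lact a f n
  | TMul a b => lact a (lact b f) n
  end.

Lemma lact_lin t (c : K) (f g : int -> leavitt) n :
  lact t (fun m => c *: f m + g m) n = c *: lact t f n + lact t g n.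
Proof.
elim: t f g n => [[A|e|e]||a IHa b IHb|a IHa|d a IHa|a IHa b IHb] f g n /=.
- by rewrite nmulDr nmulZr.
- by rewrite nmulDr nmulZr.
- by rewrite nmulDr nmulZr.
- by rewrite scaler0 addr0.
- by rewrite IHa IHb scalerDr addrACA.
- by rewrite IHa opprD scalerN.
- by rewrite IHa scalerDr !scalerA mulrC.
- by rewrite (_ : lact b _ = fun m => c *: lact b f m + lact b g m) ?IHa //;
    apply/funext => m; exact: IHb.
Qed.

Lemma lact_add t f g n :
  lact t (fun m => f m + g m) n = lact t f n + lact t g n.
Proof.
rewrite -[X in _ = X + _]scale1r -lact_lin; congr lact.
by apply/funext => m; rewrite scale1r.
Qed.

Lemma lact_0 t n : lact t (fun=> 0) n = 0.
Proof.
have := lact_add t (fun=> 0) (fun=> 0) n.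
under eq_fun do rewrite addr0.
by move/eqP; rewrite -subr_eq0 opprD addNKr oppr_eq0 => /eqP.
Qed.

Lemma lact_scale t (c : K) f n :
  lact t (fun m => c *: f m) n = c *: lact t f n.
Proof.
rewrite -[RHS]addr0 -(lact_0 t n) -lact_lin; congr lact.
by apply/funext => m; rewrite addr0.
Qed.

Lemma lact_cong a b : tcong lrel a b -> forall f, lact a f = lact b f.
Proof.
elim=> {a b} [a b ab|a|a b _ IH|a b c _ IH1 _ IH2|a a' b b' _ IH1 _ IH2|a a' _ IH
  |c a a' _ IH|a a' b b' _ IH1 _ IH2|a b c|a b|a|a|c d a|a|c a b|a c d|a b c|a b c
  |a b c|c a b|c a b] f; try apply/funext => n /=.
- case: a b / ab => [|A B|A B|e|e|e|e|e e'|v rv] /=.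
  + by rewrite lp0 nmul0r.
  + by rewrite nmulA lpM.
  + by rewrite lpU !nmulDl nmulNr.
  + by rewrite nmulA lp_ls.
  + by rewrite nmulA ls_lp.
  + by rewrite nmulA lp_lss.
  + by rewrite nmulA lss_lp.
  + by rewrite nmulA lss_ls addrK; case: eqP => //= _; rewrite nmul0r.
  + rewrite lp_reg // nmul_suml.
    elim: (fset_set _ : seq _) => [|e es IH]; first by rewrite !big_nil.
    by rewrite !big_cons /= -IH nmulA subrK.
- by [].
- by rewrite IH.
- by rewrite IH1 IH2.
- by rewrite IH1 IH2.
- by rewrite IH.
- by rewrite IH.
- by rewrite IH1 IH2.
- by rewrite addrA.
- by rewrite addrC.
- by rewrite add0r.
- by rewrite addNr.
- by rewrite scalerA.
- by rewrite scale1r.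
- by rewrite scalerDr.
- by rewrite scalerDl.
- by [].
- by [].
- exact: lact_add.
- by [].
- exact: lact_scale.
Qed.

Definition lop (x : leavitt) : (int -> leavitt) -> int -> leavitt := lact (repr x).

Lemma lop_cls t : lop (lcls t) = lact t.
Proof. by apply/funext => f; apply: lact_cong; exact: repr_pcls. Qed.

Lemma lop0 f n : lop 0 f n = 0.
Proof. by rewrite -lcls0 lop_cls. Qed.
Lemma lopD x y f n : lop (x + y) f n = lop x f n + lop y f n.
Proof.
have [[a ->] [b ->]] := conj (lcls_surj x) (lcls_surj y).
by rewrite -lclsD !lop_cls.
Qed.
Lemma lopZ c x f n : lop (c *: x) f n = c *: lop x f n.
Proof. by have [a ->] := lcls_surj x; rewrite -lclsZ !lop_cls. Qed.
Lemma lopM x y f n : lop (x ** y) f n = lop x (lop y f) n.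
Proof.
have [[a ->] [b ->]] := conj (lcls_surj x) (lcls_surj y).
by rewrite -lclsM !lop_cls.
Qed.
Lemma lop_sum I (s : seq I) (F : I -> leavitt) f n :
  lop (\sum_(i <- s) F i) f n = \sum_(i <- s) lop (F i) f n.
Proof. by elim: s => [|i s IH]; rewrite ?big_nil ?lop0 // !big_cons lopD IH. Qed.

Definition lshift (d : int) (x : leavitt) :=
  forall f n, lop x f n = x ** f (n - d).

Lemma lshiftM d e x y : lshift d x -> lshift e y -> lshift (d + e) (x ** y).
Proof. by move=> dx ey f n; rewrite lopM dx ey nmulA opprD addrA. Qed.
Lemma lshift_p A : lshift 0 (lp A).
Proof. by move=> f n; rewrite lop_cls /= subr0. Qed.
Lemma lshift_s e : lshift 1 (ls e).
Proof. by move=> f n; rewrite lop_cls. Qed.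
Lemma lshift_ss e : lshift (-1) (lss e).
Proof. by move=> f n; rewrite lop_cls /= opprK. Qed.

Lemma lhom_shift d x : lhom d x -> lshift d x.
Proof.
move=> [r rd ->] f n; rewrite lop_sum nmul_suml !big_seq.
apply: eq_bigr => c /rd; rewrite lopZ nmulZl => xd; congr (_ *: _).
move: c.2 xd f n => {x r rd c} _ [a [A [b [<- ->]]]].
apply: lshiftM; last first.
  case: b => [B|e es _] /=; first by rewrite oppr0; exact: lshift_p.
  elim: es e => [|f es IH] e /=; first exact: lshift_ss.
  by rewrite intS opprD addrC; apply: lshiftM (IH f) (lshift_ss e).
rewrite -[_%:Z]addr0; apply: lshiftM (lshift_p A).
case: a => [B|e es _] /=; first exact: lshift_p.
elim: es e => [|f es IH] e /=; first exact: lshift_s.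
by rewrite intS; apply: lshiftM (lshift_s e) (IH f).
Qed.

Lemma lhom_indep (s : seq int) (F : int -> leavitt) : uniq s ->
  (forall n, lhom n (F n)) -> \sum_(n <- s) F n = 0 ->
  forall n, n \in s -> F n = 0.
Proof.
move=> us FH F0 n ns; have [A FA] := leavitt_unit (F n).
pose f (k : int) : leavitt := if k == 0 then lp A else 0.
have : lop (\sum_(m <- s) F m) f n = F n.
  rewrite lop_sum (bigD1_seq n) //= (lhom_shift (FH n)) subrr /f eqxx FA.
  rewrite big1 ?addr0 // => i ine; rewrite (lhom_shift (FH i)).
  by rewrite subr_eq0 eq_sym (negbTE ine) nmulr0.
by rewrite F0 lop0.
Qed.

HB.instance Definition _ := NAlgebra_isGraded.Build K leavitt
  lhom0 lhomD lhomZ lhomM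
  (direct_sumP lhom0 lhomD lhomZ lhom_span lhom_indep).
End Leavitt.

(* Vertices v_n and edges e_n are encoded by the pairs (v, n) and (e, n). *)
Lemma skew_rng_neq0 (G : ultragraph) (e : edge G * int) :
  ((fun w => (w, e.2 - 1)) @` rng e.1) !=set0.
Proof. by have [w we] := rng_neq0 e.1; exists (w, e.2 - 1), w. Qed.

Definition skew_product (G : ultragraph) : ultragraph :=
  @Ultragraph (vtx G * int)%type (edge G * int)%type
    (fun e => (src e.1, e.2)) (fun e => (fun w => (w, e.2 - 1)) @` rng e.1)
    (@skew_rng_neq0 G).

(* Main.v *)
(* Write A_n for the slice of a vertex set A at level n. The isomorphism f sends
   p_A to \sum_n p_{A_n} p_n, s_{e_n} to s_e p_{n-1} and s_{e_n}^* to s_e^* p_n.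
   It is graded, and its image contains every x p_n by induction on homogeneous x.
   Instead of the graded uniqueness theorem, injectivity uses a representation
   rho of L_K(G) on sequences g : Z -> L_K(G x_1 Z),
     (p_A g)(n) = p_{A x {n}} g(n),  (s_e g)(n) = s_{e_n} g(n-1),
     (s_e^* g)(n) = s_{e_{n+1}}^* g(n+1).
   With p_n acting as the projection to coordinate n, it extends to the smash
   product, and f(x) then acts on the levels of any y in L_K(G x_1 Z) as left
   multiplication by x. So f(x) = 0 forces x y = 0 for all y, and x = 0 because
   the algebra has local units. *)
From HB Require Import structures.
Require Import Defs.
From mathcomp Require Import all_boot all_algebra.
From mathcomp Require Import finmap boolp classical_sets functions.
From mathcomp Require Import cardinality fsbigop.

Set Implicit Arguments.
Unset Strict Implicit.
Unset Printing Implicit Defensive.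

Import GRing.Theory.
Local Open Scope classical_set_scope.
Local Open Scope ring_scope.

(** * Homomorphisms of algebras without unit and the universal property of a presentation *)

Definition nalg_hom (K : fieldType) (A B : nalgType K) (f : A -> B) : Prop :=
  linear f /\ {morph f : x y / x ** y}.

Section NAlgHom.
Context {K : fieldType} {A B : nalgType K} {f : A -> B}.
Hypothesis fh : nalg_hom f.

Lemma nalg_homD x y : f (x + y) = f x + f y.
Proof. by have := fh.1 1 x y; rewrite !scale1r. Qed.
Lemma nalg_hom0 : f 0 = 0.
Proof. by apply: (addrI (f 0)); rewrite -nalg_homD !addr0. Qed.
Lemma nalg_homZ c x : f (c *: x) = c *: f x.
Proof. by have := fh.1 c x 0; rewrite !addr0 nalg_hom0 addr0. Qed.
Lemma nalg_homB x y : f (x - y) = f x - f y.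
Proof. by rewrite -scaleN1r nalg_homD nalg_homZ scaleN1r. Qed.
Lemma nalg_homM x y : f (x ** y) = f x ** f y.
Proof. exact: fh.2. Qed.
Lemma nalg_hom_sum I (s : seq I) (F : I -> A) :
  f (\sum_(i <- s) F i) = \sum_(i <- s) f (F i).
Proof.
by elim: s => [|i s IH]; rewrite ?big_nil ?nalg_hom0 // !big_cons nalg_homD IH.
Qed.
End NAlgHom.

Section PresentedUniversal.
Context {K : fieldType} {X : Type} {B : nalgType K}.

Fixpoint teval (h : X -> B) (t : nterm K X) : B :=
  match t with
  | TGen x => h x
  | TZero => 0
  | TAdd a b => teval h a + teval h b
  | TOpp a => - teval h a
  | TScale c a => c *: teval h a
  | TMul a b => teval h a ** teval h b
  end.

Lemma teval_sum h I (r : seq I) (F : I -> nterm K X) :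
  teval h (\big[@TAdd _ _/TZero]_(i <- r) F i) = \sum_(i <- r) teval h (F i).
Proof.
by elim: r => [|i r IH]; rewrite ?big_nil // !big_cons -IH.
Qed.

Variable R : nterm K X -> nterm K X -> Prop.

Lemma teval_cong h : (forall a b, R a b -> teval h a = teval h b) ->
  forall a b, tcong R a b -> teval h a = teval h b.
Proof.
move=> hR a b; elim=> {a b} //=.
- by move=> a b c _ -> _ ->.
- by move=> a a' b b' _ -> _ ->.
- by move=> a a' _ ->.
- by move=> c a a' _ ->.
- by move=> a a' b b' _ -> _ ->.
- by move=> a b c; rewrite addrA.
- by move=> a b; rewrite addrC.
- by move=> a; rewrite add0r.
- by move=> a; rewrite addNr.
- by move=> c d a; rewrite scalerA.
- by move=> a; rewrite scale1r.
- by move=> c a b; rewrite scalerDr.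
- by move=> a c d; rewrite scalerDl.
- by move=> a b c; rewrite nmulA.
- by move=> a b c; rewrite nmulDl.
- by move=> a b c; rewrite nmulDr.
- by move=> c a b; rewrite nmulZl.
- by move=> c a b; rewrite nmulZr.
Qed.

Lemma presented_universal h : (forall a b, R a b -> teval h a = teval h b) ->
  exists2 f : presented R -> B, nalg_hom f & forall x, f (pcls R (TGen x)) = h x.
Proof.
move=> hR; pose f (x : presented R) := teval h (repr x).
have fE t : f (pcls R t) = teval h t by apply: (teval_cong hR); exact: repr_pcls.
exists f => [|x]; last exact: fE.
split=> [c x y|x y]; have [[a ->] [b ->]] := conj (pcls_surj x) (pcls_surj y).
  by rewrite -pclsZ -pclsD !fE.
by rewrite -pclsM !fE.
Qed.
End PresentedUniversal.

(** Applied twice: once to the images of the generators in the smash product, once to operators on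
    sequences. *)
Lemma leavitt_universal (K : fieldType) (G : ultragraph) (B : nalgType K)
    (P : gvtx G -> B) (S T : edge G -> B) :
  P gvtx0 = 0 -> (forall A C, P A ** P C = P (gvtxI A C)) ->
  (forall A C, P (gvtxU A C) = P A + P C - P (gvtxI A C)) ->
  (forall e, P (gvtx1 (src e)) ** S e = S e) ->
  (forall e, S e ** P (gvtxr e) = S e) ->
  (forall e, P (gvtxr e) ** T e = T e) ->
  (forall e, T e ** P (gvtx1 (src e)) = T e) ->
  (forall e f, T e ** S f = if e == f then P (gvtxr e) else 0) ->
  (forall v, regular v ->
    P (gvtx1 v) = \sum_(e <- fset_set (src @^-1` [set v])) S e ** T e) ->
  exists2 f : leavitt K G -> B, nalg_hom f &
    [/\ forall A, f (lp K A) = P A, forall e, f (ls K e) = S e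
      & forall e, f (lss K e) = T e].
Proof.
move=> P0 PI PU PS SP PT TP TS Preg.
pose h (g : lgen G) := match g with Lp A => P A | Ls e => S e | Lss e => T e end.
have [|f fh fE] := @presented_universal K _ B (@lrel K G) h.
  move=> _ _ [] //= => [e f|v rv]; first by rewrite TS; case: ifP.
  by rewrite Preg // teval_sum.
by exists f => //; split=> x; exact: fE.
Qed.

(** * Induction on homogeneous elements and left local units in Leavitt path algebras *)

Section GradedInduction.
Context {K : fieldType} {G : ultragraph}.
Local Notation L := (leavitt K G).

Lemma homog_lp (A : gvtx G) : homog 0 (lp K A).
Proof.
apply: lhom_monom; exists (PSet A), A, (PSet A); split=> //=.
by rewrite !lpM; congr lp; apply: gvtxP; rewrite /= !setIid.
Qed.
Lemma homog_ls (e : edge G) : homog 1 (ls K e).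
Proof. by rewrite -ls_lp; exact: (lhom_ls e (homog_lp _)). Qed.
Lemma homog_lss (e : edge G) : homog (-1) (lss K e).
Proof. by rewrite -lss_lp; exact: (lhom_lss e (homog_lp _)). Qed.

Lemma hcompM (A : gradedType K) n (x y : A) :
  hcomp n (x ** y) = \sum_(m <- hsupp y) hcomp (n - m) x ** hcomp m y.
Proof.
rewrite {1}(@hcomp_sum _ _ y (hsupp y)) ?fset_uniq // nmul_sumr hcomp_sumE.
by apply: eq_bigr => m _; rewrite (hcompMr _ _ (hcomp_hom _ _)).
Qed.

(** Ordinary induction does not see degrees, so the claim is carried through all components
    [hcomp n x] at once: those of a generator are the generator or 0, and those of a product are
    finite sums of products of components whose degrees add up to n. *)
Lemma leavitt_graded_ind (P : int -> L -> Prop) :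
  (forall A, P 0 (lp K A)) -> (forall e, P 1 (ls K e)) ->
  (forall e, P (-1) (lss K e)) -> (forall n, P n 0) ->
  (forall n x y, P n x -> P n y -> P n (x + y)) ->
  (forall n c x, P n x -> P n (c *: x)) ->
  (forall m n x y, homog m x -> homog n y -> P m x -> P n y ->
    P (m + n) (x ** y)) ->
  forall n x, homog n x -> P n x.
Proof.
move=> Pp Ps Pss P0 PD PZ PM n x xn.
suff: P n (hcomp n x) by rewrite (hcomp_id _ xn) eqxx.
elim/leavitt_ind: x n {xn} => [A|e|e||x y Px Py|c x Px|x y Px Py] n.
- by rewrite (hcomp_id _ (homog_lp A)); case: eqP => [->|].
- by rewrite (hcomp_id _ (homog_ls e)); case: eqP => [->|].
- by rewrite (hcomp_id _ (homog_lss e)); case: eqP => [->|].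
- by rewrite hcomp0.
- by rewrite hcompD; exact: PD.
- by rewrite hcompZ; exact: PZ.
- rewrite hcompM; elim/big_ind: _ => [||m _]; [exact: P0|exact: PD|].
  by rewrite -{1}(subrK m n); apply: PM => //; exact: hcomp_hom.
Qed.

(** A unit for a sum comes from the union of the sets that serve the summands; a product inherits
    the unit of its left factor. *)
Lemma leavitt_left_unit (x : L) : exists A, lp K A ** x = x.
Proof.
have sub (z : L) A B : lp K A ** z = z ->
    lp K (gvtxU A B) ** z = z /\ lp K (gvtxU B A) ** z = z.
  move=> zA; split; rewrite -{1}zA nmulA lpM -[RHS]zA; congr (lp K _ ** _);
    apply: gvtxP => /=; apply/seteqP; split=> [v []//|v Av]; split=> //;
    by [left|right].
elim/leavitt_ind: x => [A|e|e||x y [A xA] [B yB]|c x [A xA]|x y [A xA] _].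
- by exists A; rewrite lpM; congr lp; apply: gvtxP; rewrite /= setIid.
- by exists (gvtx1 (src e)); exact: lp_ls.
- by exists (gvtxr e); exact: lp_lss.
- by exists gvtx0; rewrite nmulr0.
- exists (gvtxU A B); rewrite nmulDr.
  by have [-> _] := sub _ _ B xA; have [_ ->] := sub _ _ A yB.
- by exists A; rewrite nmulZr xA.
- by exists A; rewrite nmulA xA.
Qed.
End GradedInduction.

(** In the sum over m of [F m ** hcomp (m - n) (H n)] only m = n + d survives. Generators of the
    skew product are sent to elements with homogeneous coefficients, so multiplying by these on the
    right needs no sums. *)
Lemma smash_mul_homog (K : fieldType) (A : gradedType K) (F H : smash A) n d :
  homog d (H n) -> (F ** H) n = F (n + d) ** H n.
Proof.
move=> Hd; have [s us Fs] := smash_supp F.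
rewrite (smash_mulE H n us Fs).
under eq_bigr => m _ do rewrite (hcomp_id _ Hd) subr_eq addrC.
have [ns|/(contraNN (Fs _))/negPn/eqP F0] := boolP (n + d \in s).
  rewrite (bigD1_seq (n + d)) //= eqxx big1 ?addr0 // => m mn.
  by rewrite (negbTE mn) nmulr0.
by rewrite F0 nmul0r big1 // => m _; case: eqP => [->|_]; rewrite ?nmulr0 ?F0 ?nmul0r.
Qed.

(** * The algebra of linear endomorphisms of a module under composition *)

Section Endomorphisms.
Context {K : fieldType} (V : lmodType K).

Definition linearf : {pred V -> V} := fun f => `[< linear f >].

Lemma linearf_submod : submod_closed linearf.
Proof.
split=> [|c f g /asboolP fl /asboolP gl]; apply/asboolP => d x y.
  by rewrite scaler0 addr0.
have E z : (c *: f + g) z = c *: f z + g z by [].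
by rewrite !E fl gl !scalerDr !scalerA addrACA mulrC.
Qed.
HB.instance Definition _ := GRing.isSubmodClosed.Build K (V -> V) linearf
  linearf_submod.

Record lendo := Lendo { lendo_fun :> V -> V; lendo_funP : lendo_fun \in linearf }.
HB.instance Definition _ := [isSub for lendo_fun].
HB.instance Definition _ := [Choice of lendo by <:].
HB.instance Definition _ := [SubChoice_isSubLmodule of lendo by <:].

Implicit Types f g h : lendo.

Lemma lendoP f g : (forall x, f x = g x) -> f = g.
Proof. by move=> fg; apply: val_inj; apply/funext. Qed.

Lemma lendo_lin f : linear f.
Proof. by have /asboolP := lendo_funP f. Qed.
Lemma lendoDr f x y : f (x + y) = f x + f y.
Proof. by have := lendo_lin f 1 x y; rewrite !scale1r. Qed.
Lemma lendor0 f : f 0 = 0.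
Proof. by apply: (addrI (f 0)); rewrite -lendoDr !addr0. Qed.
Lemma lendoZr f c x : f (c *: x) = c *: f x.
Proof. by have := lendo_lin f c x 0; rewrite !addr0 lendor0 addr0. Qed.

Lemma lendo_comp_subproof f g : f \o g \in linearf.
Proof. by apply/asboolP => c x y /=; rewrite !lendo_lin. Qed.
Definition lendo_comp f g := Lendo (lendo_comp_subproof f g).

Lemma lendo_compA : associative lendo_comp.
Proof. by move=> f g h; exact: lendoP. Qed.
Lemma lendo_compDl : left_distributive lendo_comp +%R.
Proof. by move=> f g h; exact: lendoP. Qed.
Lemma lendo_compDr : right_distributive lendo_comp +%R.
Proof. by move=> f g h; apply: lendoP => x; exact: lendoDr. Qed.
Lemma lendo_compZl c f g : lendo_comp (c *: f) g = c *: lendo_comp f g.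
Proof. exact: lendoP. Qed.
Lemma lendo_compZr c f g : lendo_comp f (c *: g) = c *: lendo_comp f g.
Proof. by apply: lendoP => x; exact: lendoZr. Qed.
HB.instance Definition _ := Lmodule_isNAlgebra.Build K lendo
  lendo_compA lendo_compDl lendo_compDr lendo_compZl lendo_compZr.

Lemma lendoME f g x : (f ** g) x = f (g x).
Proof. by []. Qed.
Lemma lendo_sumE I (s : seq I) (F : I -> lendo) x :
  (\sum_(i <- s) F i) x = \sum_(i <- s) F i x.
Proof.
elim: s => [|i s IH]; first by rewrite !big_nil.
by rewrite !big_cons -IH.
Qed.
End Endomorphisms.

(** * Homomorphisms out of a smash product, and a criterion for graded isomorphisms *)

Section SmashUniversal.
Context {K : fieldType} {A : gradedType K} {B : nalgType K}.
Variables (rho : A -> B) (delta : int -> B).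
Hypothesis rho_hom : nalg_hom rho.
Hypothesis delta_rho : forall k n x,
  delta k ** rho x ** delta n = rho (hcomp (k - n) x) ** delta n.

(** Here [delta n] stands for p_n, and [delta_rho] is the smash rule p_k x p_n = x_(k-n) p_n read in
    B. *)
Definition smash_map (F : smash A) : B :=
  \sum_(n \in [set: int]) rho (F n) ** delta n.

Lemma smash_mapE (F : smash A) (s : seq int) : uniq s -> (forall n, F n != 0 -> n \in s) ->
  smash_map F = \sum_(n <- s) rho (F n) ** delta n.
Proof.
move=> us Fs; apply: fsumE => // n; apply: contraR.
move=> /(contraNN (Fs n))/negPn/eqP->.
by rewrite (nalg_hom0 rho_hom) nmul0r.
Qed.

Lemma smash_map_hom : nalg_hom smash_map.
Proof.
split=> [c F H|F H].
  have [s us FHs] := smash_supp2 F H.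
  have Fs n : F n != 0 -> n \in s by move=> Fn; apply: FHs; left.
  have Hs n : H n != 0 -> n \in s by move=> Hn; apply: FHs; right.
  rewrite (smash_mapE us Fs) (smash_mapE us Hs) (@smash_mapE _ s) //.
    rewrite scaler_sumr -big_split; apply: eq_bigr => n _.
    by rewrite rho_hom.1 nmulDl nmulZl.
  move=> n; apply: contraR => ns; rewrite smashDE smashZE.
  move/(contraNN (Fs n)): (ns) => /negPn/eqP->.
  by move/(contraNN (Hs n)): (ns) => /negPn/eqP->; rewrite scaler0 addr0.
have [s us Fs] := smash_supp F; have [t ut Ht] := smash_supp H.
rewrite (smash_mapE us Fs) (smash_mapE ut Ht) (@smash_mapE _ t) //; last first.
  move=> n; apply: contraR => /(contraNN (Ht n))/negPn/eqP H0.
  by rewrite (@smash_mul_homog _ _ _ _ _ 0) ?H0 ?nmulr0 //; exact: hom0.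
rewrite nmul_sumr; apply: eq_bigr => n _; rewrite (smash_mulE H n us Fs).
rewrite (nalg_hom_sum rho_hom) !nmul_suml; apply: eq_bigr => k _.
(* Read backwards, [delta_rho] absorbs the component of degree k - n and restores the factor
   [delta k] that belongs to [F k]. *)
by rewrite (nalg_homM rho_hom) -!nmulA -delta_rho !nmulA.
Qed.

Lemma smash_map_term r n : smash_map (smash_term r n) = rho r ** delta n.
Proof.
rewrite (@smash_mapE _ [:: n]) ?big_seq1 /= ?eqxx // => k.
by rewrite inE /=; case: ifP => //; rewrite eqxx.
Qed.
End SmashUniversal.

Lemma smash_term_hom (K : fieldType) (A : gradedType K) (d n : int) (r : A) :
  homog d r -> homog d (smash_term r n).
Proof. by move=> rd k /=; case: ifP => // _; exact: hom0. Qed.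

(** By uniqueness of the decomposition, a map that preserves degrees commutes with taking
    components. A preimage of a homogeneous y can then be replaced by its component of the same
    degree, so each homogeneous part is hit by the corresponding one. *)
Lemma graded_iso_of_hom (K : fieldType) (A B : gradedType K) (f : A -> B) :
  nalg_hom f -> (forall x, f x = 0 -> x = 0) -> (forall y, exists x, f x = y) ->
  (forall n x, homog n x -> homog n (f x)) -> graded_iso f.
Proof.
move=> fh f0 fs fg.
have finj : injective f.
  move=> x y xy; apply/eqP; rewrite -subr_eq0; apply/eqP/f0.
  by rewrite (nalg_homB fh) xy subrr.
have fhc x n : f (hcomp n x) = hcomp n (f x).
  apply/esym; apply: (@hcompP _ _ _ (hsupp x) (fun n => f (hcomp n x))) => [||m|].
  - exact: fset_uniq.
  - by move=> m; apply/fg/hcomp_hom.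
  - by apply: contraR => /(contraNN (@hsuppP _ _ m x))/negPn/eqP->; rewrite (nalg_hom0 fh).
  - by rewrite -(nalg_hom_sum fh) -hcomp_sum ?fset_uniq.
split; [exact: fh.1|exact: fh.2| |move=> n].
  have [g gK] := choice fs; exists g => // x; apply: finj; exact: gK.
apply/seteqP; split=> [_ [x xn <-]|y yn]; first exact: fg.
have [x xy] := fs y; exists (hcomp n x); first exact: hcomp_hom.
by rewrite fhc xy (hcomp_id _ yn) eqxx.
Qed.

(** * Vertex sets and regular vertices of the skew product, level by level *)

Section SkewProduct.
Context {G : ultragraph}.
Local Notation G' := (skew_product G).

Lemma slice_gen (A : gvtx G') (n : int) : gen_vtx G [set v | sval A (v, n)].
Proof.
case: A => A /=; elim=> {A} [|[v m]|[e m]|A B _ IHA _ IHB|A B _ IHA _ IHB].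
- exact: gv_set0.
- have [->|nm] := eqVneq n m.
    rewrite (_ : mkset _ = [set v]); first exact: gv_set1.
    by apply/seteqP; split=> w /=; [case|move->].
  rewrite (_ : mkset _ = set0); first exact: gv_set0.
  by apply/seteqP; split=> w //= -[_ /eqP]; rewrite (negbTE nm).
- have [->|nm] := eqVneq n (m - 1).
    rewrite (_ : mkset _ = rng e); first exact: gv_rng.
    by apply/seteqP; split=> w /=; [case=> ? ? [<-]|exists w].
  rewrite (_ : mkset _ = set0); first exact: gv_set0.
  by apply/seteqP; split=> w //= -[_ _ [_ /esym/eqP]]; rewrite (negbTE nm).
- exact: gv_setU IHA IHB.
- exact: gv_setI IHA IHB.
Qed.
Definition slice (A : gvtx G') (n : int) : gvtx G := exist _ _ (slice_gen A n).

Lemma level_gen (A : gvtx G) (n : int) :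
  gen_vtx G' ((fun v => (v, n)) @` sval A).
Proof.
case: A => A /=; elim=> {A} [|v|e|A B _ IHA _ IHB|A B _ IHA _ IHB].
- by rewrite image_set0; exact: gv_set0.
- by rewrite image_set1; exact: gv_set1.
(* Ranges drop by one level: the copy of r(e) on level n is the range of e_(n+1). *)
- by rewrite -{1}(addrK 1 n); exact: (@gv_rng G' (e, n + 1)).
- by rewrite image_setU; exact: gv_setU.
- rewrite (_ : _ @` _ = ((fun v => (v, n)) @` A) `&` ((fun v => (v, n)) @` B)).
    exact: gv_setI.
  apply/seteqP; split=> [_ [v [Av Bv] <-]|_ [[v Av <-] [w Bw [wv]]]].
    by split; exists v.
  by exists v => //; split=> //; rewrite -wv.
Qed.
Definition level (A : gvtx G) (n : int) : gvtx G' := exist _ _ (level_gen A n).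

Lemma levelE A n v m : sval (level A n) (v, m) <-> sval A v /\ m = n.
Proof. by split=> [[w Aw [<- <-]]|[Av ->]]; last exists v. Qed.

Lemma level0 n : level gvtx0 n = gvtx0.
Proof. by apply: gvtxP; rewrite /= image_set0. Qed.
Lemma levelI A B n : level (gvtxI A B) n = gvtxI (level A n) (level B n).
Proof.
apply: gvtxP; apply/seteqP; split=> -[v m].
  by move=> /levelE[[Av Bv] ->]; split; apply/levelE.
by move=> [/levelE[Av ->] /levelE[Bv _]]; apply/levelE.
Qed.
Lemma levelU A B n : level (gvtxU A B) n = gvtxU (level A n) (level B n).
Proof. by apply: gvtxP; rewrite /= image_setU. Qed.
Lemma level1 v n : level (gvtx1 v) n = @gvtx1 G' (v, n).
Proof. by apply: gvtxP; rewrite /= image_set1. Qed.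
Lemma levelr e n : level (gvtxr e) (n - 1) = @gvtxr G' (e, n).
Proof. exact: gvtxP. Qed.

Lemma sliceI A B n : slice (gvtxI A B) n = gvtxI (slice A n) (slice B n).
Proof. exact: gvtxP. Qed.
Lemma sliceU A B n : slice (gvtxU A B) n = gvtxU (slice A n) (slice B n).
Proof. exact: gvtxP. Qed.
Lemma slice0 n : slice gvtx0 n = gvtx0.
Proof. exact: gvtxP. Qed.
Lemma slice_level A n m : slice (level A n) m = if m == n then A else gvtx0.
Proof.
apply: gvtxP; apply/seteqP; split=> v /=.
  by move=> /levelE[Av ->]; rewrite eqxx.
by case: eqP => [->|//] Av; apply/levelE.
Qed.
Lemma slice1 v n m : slice (@gvtx1 G' (v, n)) m = if m == n then gvtx1 v else gvtx0.
Proof. by rewrite -level1 slice_level. Qed.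
Lemma slicer e n m :
  slice (@gvtxr G' (e, n)) m = if m == n - 1 then gvtxr e else gvtx0.
Proof. by rewrite -levelr slice_level. Qed.

Lemma gvtxI_level A B n : gvtxI (level A n) B = level (gvtxI A (slice B n)) n.
Proof.
apply: gvtxP; apply/seteqP; split=> -[v m].
  by move=> [/levelE[Av ->] Bv]; apply/levelE.
by move=> /levelE[[Av Bv] ->]; split=> //; apply/levelE.
Qed.

(** Singletons and ranges lie on one level, and unions and intersections keep the number of levels
    finite. This is what makes the image of p_A a finite formal sum. *)
Lemma slice_supp (A : gvtx G') :
  exists s : seq int, forall n, n \notin s -> slice A n = gvtx0.
Proof.
suff [s sA] : exists s : seq int, forall v n, sval A (v, n) -> n \in s.
  exists s => n ns; apply: gvtxP; apply/seteqP; split=> // v /sA.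
  by rewrite (negbTE ns).
case: A => A /=; elim=> {A} [|[v m]|[e m]|A B _ [s sA] _ [t tB]|A B _ [s sA] _ _].
- by exists [::].
- by exists [:: m] => w n [_ ->]; rewrite inE.
- by exists [:: m - 1] => w n [_ _ [_ <-]]; rewrite inE.
- by exists (s ++ t) => v n; rewrite mem_cat => -[/sA->|/tB->]; rewrite ?orbT.
- by exists s => v n [/sA].
Qed.

Lemma skew_src_fiber (v : vtx G) (n : int) :
  @src G' @^-1` [set (v, n)] = (fun e => (e, n)) @` (src @^-1` [set v]).
Proof.
by apply/seteqP; split=> [[e m] /= [<- <-]|_ [e <- <-]]; first exists e.
Qed.

(** The edges out of v_n are the e_n with s(e) = v, so relation (4) at v_n and at v is indexed by
    the same edges. *)
Lemma regular_skew (v : vtx G) (n : int) : @regular G' (v, n) <-> regular v.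
Proof.
have inj : injective (fun e : edge G => (e, n)) by move=> e f [].
rewrite /regular skew_src_fiber; split=> -[fin [e ev]]; split.
- rewrite (_ : src @^-1` _ = fst @` ((fun e => (e, n)) @` (src @^-1` [set v]))).
    exact: finite_image.
  by rewrite image_comp image_id.
- by move: ev => [f fv _]; exists f.
- exact: finite_image.
- by exists (e, n), e.
Qed.

Lemma sum_skew_fiber (V : nmodType) (F : edge G' -> V) v n : regular v ->
  \sum_(e <- fset_set (@src G' @^-1` [set (v, n)])) F e =
  \sum_(e <- fset_set (src @^-1` [set v])) F (e, n).
Proof.
move=> rv; have rv' := (regular_skew v n).2 rv.
transitivity (\sum_(e <- [seq (e, n) | e <- fset_set (src @^-1` [set v])]) F e);
  last by rewrite big_map.
apply: perm_big; apply: uniq_perm; first exact: fset_uniq.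
  by rewrite map_inj_uniq ?fset_uniq // => e f [].
move=> e; rewrite in_fset_set; last exact: rv'.1.
rewrite skew_src_fiber; apply/idP/mapP => [/set_mem[f fv <-]|[f fv ->]].
  by exists f => //; rewrite in_fset_set ?mem_set //; exact: rv.1.
apply: mem_set; exists f => //.
by move: fv; rewrite in_fset_set => [/set_mem //|]; exact: rv.1.
Qed.
End SkewProduct.

(** * The homomorphism from the algebra of the skew product to the smash product *)

Section Isomorphism.
Context {K : fieldType} {G : ultragraph}.
Local Notation G' := (skew_product G).
Local Notation L := (leavitt K G).
Local Notation L' := (leavitt K G').
Local Notation S := (smash L).

Lemma smash_p_subproof (A : gvtx G') : (fun n => lp K (slice A n) : L) \in @finsuppf K L.
Proof.
have [s sA] := slice_supp A; apply: (@finsuppfP _ _ _ s) => n.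
by apply: contraR => /sA->; rewrite lp0.
Qed.
Definition smash_p A : S := Smash (smash_p_subproof A).
(** Since s_e has degree 1, s_e p_(n-1) = p_n s_e p_(n-1): the term leads from level n to level n -
    1, as e_n does. *)
Definition smash_s (e : edge G') : S := smash_term (ls K e.1 : L) (e.2 - 1).
Definition smash_ss (e : edge G') : S := smash_term (lss K e.1 : L) e.2.

Lemma smash_mul_p (F : S) A n : (F ** smash_p A) n = F n ** lp K (slice A n).
Proof. by rewrite (@smash_mul_homog _ _ _ _ _ 0) ?addr0 //; exact: homog_lp. Qed.
Lemma smash_mul_s (F : S) e n : (F ** smash_s e) n = F (n + 1) ** smash_s e n.
Proof. by apply: smash_mul_homog; apply: smash_term_hom; exact: homog_ls. Qed.
Lemma smash_mul_ss (F : S) e n : (F ** smash_ss e) n = F (n - 1) ** smash_ss e n.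
Proof. by apply: smash_mul_homog; apply: smash_term_hom; exact: homog_lss. Qed.

(** The relations are compared coefficient by coefficient, which reduces each to the same relation
    in L_K(G); in those that involve edges both sides vanish off a single level. *)
Lemma skew_to_smash : exists2 f : L' -> S, nalg_hom f &
  [/\ forall A, f (lp K A) = smash_p A, forall e, f (ls K e) = smash_s e
    & forall e, f (lss K e) = smash_ss e].
Proof.
apply: (@leavitt_universal _ _ S smash_p smash_s smash_ss) =>
  [|A B|A B|[e m]|[e m]|[e m]|[e m]|[e m] [f k]|[v m] rv]; apply: smashP => n.
- by rewrite /= slice0 lp0.
- by rewrite smash_mul_p /= lpM sliceI.
- by rewrite /= sliceU lpU -sliceI.
- rewrite smash_mul_s /= slice1; case: (eqVneq n (m - 1)) => [->|_]; last by rewrite nmulr0.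
  by rewrite subrK eqxx lp_ls.
- rewrite smash_mul_p /= slicer; case: eqP => _; last by rewrite nmul0r.
  exact: ls_lp.
- rewrite smash_mul_ss /= slicer; case: (eqVneq n m) => [->|_]; last by rewrite nmulr0.
  by rewrite eqxx lp_lss.
- rewrite smash_mul_p /= slice1; case: eqP => _; last by rewrite nmul0r.
  exact: lss_lp.
(* A nonzero coefficient at n needs n = k - 1 from the right factor and n + 1 = m from the left one,
   hence m = k; what remains is the relation for e and f. *)
- rewrite smash_mul_s /= -[(e, m) == _]/((e == f) && (m == k)).
  case: (eqVneq n (k - 1)) => [->|nk]; last first.
    by rewrite nmulr0; case: ifP => // /andP[_ /eqP mk]; rewrite /= slicer mk (negbTE nk) lp0.
  rewrite subrK [k == m]eq_sym; case: (eqVneq m k) => [->|_]; last first.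
    by rewrite nmul0r andbF.
  by rewrite andbT lss_ls; case: ifP => // _; rewrite /= slicer eqxx.
- rewrite sum_skew_fiber ?smash_sumE; last exact/(regular_skew v m).
  under eq_bigr do rewrite smash_mul_ss /=.
  rewrite /= slice1; case: eqP => [->|_].
    by rewrite eqxx lp_reg //; exact/(regular_skew v m).
  by rewrite big1 ?lp0 // => e _; rewrite nmulr0.
Qed.

(** * The homomorphism preserves degrees and is onto *)

Section Image.
Variable f : L' -> S.
Hypothesis fh : nalg_hom f.
Hypothesis fp : forall A, f (lp K A) = smash_p A.
Hypothesis fs : forall e, f (ls K e) = smash_s e.
Hypothesis fss : forall e, f (lss K e) = smash_ss e.

Lemma skew_to_smash_homog n x : homog n x -> homog n (f x).
Proof.
move: n x; apply: leavitt_graded_ind => [A|e|e|n|n x y|n c x|m n x y].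
- by rewrite fp => n; exact: homog_lp.
- by rewrite fs; apply: smash_term_hom; exact: homog_ls.
- by rewrite fss; apply: smash_term_hom; exact: homog_lss.
- by rewrite (nalg_hom0 fh); exact: hom0.
- by rewrite (nalg_homD fh); exact: homD.
- by rewrite (nalg_homZ fh); exact: homZ.
- by move=> xm yn fxm fyn; rewrite (nalg_homM fh); exact: homM.
Qed.

Lemma skew_to_smash_surj y : exists x, f x = y.
Proof.
have term d (r : L) : homog d r -> forall n, exists x, f x = smash_term r n.
  move: d r; apply: leavitt_graded_ind
    => [A|e|e|_|_ r t Pr Pt|_ c r Pr|m k r t rm tk Pr Pt] n.
  - exists (lp K (level A n)); rewrite fp; apply: smashP => k /=.
    by rewrite slice_level; case: ifP; rewrite ?lp0.
  (* The generator for e_(n+1) maps to s_e p_n. *)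
  - by exists (ls K ((e, n + 1) : edge G')); rewrite fs /smash_s /= addrK.
  - by exists (lss K ((e, n) : edge G')); rewrite fss.
  - by exists 0; rewrite (nalg_hom0 fh); apply: smashP => k /=; case: ifP.
  - have [[u fu] [v fv]] := conj (Pr n) (Pt n); exists (u + v).
    rewrite (nalg_homD fh) fu fv; apply: smashP => k.
    by rewrite smashDE /=; case: ifP; rewrite ?addr0.
  - have [u fu] := Pr n; exists (c *: u).
    rewrite (nalg_homZ fh) fu; apply: smashP => k.
    by rewrite smashZE /=; case: ifP; rewrite ?scaler0.
  (* As t has degree k, (r p_(n+k)) (t p_n) = r t p_n, so the left factor is taken at index n +
     k. *)
  - have [[u fu] [v fv]] := conj (Pr (n + k)) (Pt n); exists (u ** v).
    rewrite (nalg_homM fh) fu fv smash_termM addrAC subrr add0r.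
    by rewrite (hcomp_id _ tk) eqxx.
have [s us ys] := smash_supp y.
have sumP (F : int -> S) : (forall n, exists x, f x = F n) ->
    exists x, f x = \sum_(n <- s) F n.
  by move=> /choice[g gF]; exists (\sum_(n <- s) g n);
    rewrite (nalg_hom_sum fh); apply: eq_bigr => n _.
(* Each coefficient of y is split into homogeneous components, because [term] provides preimages
   only for homogeneous coefficients. *)
suff -> : y = \sum_(n <- s) \sum_(d <- hsupp (y n)) smash_term (hcomp d (y n)) n.
  apply: sumP => n; elim: (hsupp (y n) : seq int) => [|d t [x fx]].
    by exists 0; rewrite big_nil (nalg_hom0 fh).
  have [u fu] := term d _ (hcomp_hom d (y n)) n.
  by exists (u + x); rewrite big_cons (nalg_homD fh) fx fu.
apply: smashP => k; rewrite smash_sumE.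
under eq_bigr => n _.
  rewrite smash_sumE /= (_ : \sum_(i <- _) _ = if k == n then y n else 0); first over.
  by case: eqP => _; [rewrite -hcomp_sum ?fset_uniq|rewrite big1].
have [ks|/(contraNN (ys k))/negPn/eqP y0] := boolP (k \in s).
  by rewrite (bigD1_seq k) //= eqxx big1 ?addr0 // => n; rewrite eq_sym => /negbTE->.
by rewrite y0 big1 // => n _; case: eqP => [<-|].
Qed.
End Image.

(** * The representation of L_K(G) on sequences in the algebra of the skew product *)

Local Notation V := (int -> L').

Lemma weighted_shift_subproof (c : int -> L') (d : int) :
  (fun (f : V) n => c n ** f (n + d)) \in @linearf K V.
Proof.
apply/asboolP => a f g; apply/funext => n.
by rewrite -[(a *: f + g) _]/(a *: f (n + d) + g (n + d)) nmulDr nmulZr.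
Qed.
(** All generators act by such operators, and composing two of them multiplies weights and adds
    shifts, so the relations become identities between weights in the skew product algebra. *)
Definition weighted_shift c d : lendo V := Lendo (weighted_shift_subproof c d).

Lemma level_proj_subproof k :
  (fun (f : V) n => if n == k then f n else 0) \in @linearf K V.
Proof.
apply/asboolP => a f g; apply/funext => n.
rewrite -[RHS]/(a *: (if n == k then f n else 0) + (if n == k then g n else 0)).
by case: ifP => // _; rewrite scaler0 addr0.
Qed.
Definition level_proj k : lendo V := Lendo (level_proj_subproof k).

Definition op_p (A : gvtx G) := weighted_shift (fun n => lp K (level A n)) 0.
Definition op_s (e : edge G) := weighted_shift (fun n => ls K ((e, n) : edge G')) (-1).
(** The edge e_(n+1) leads from level n + 1 to level n, so its adjoint contributes to coordinate n
    and reads coordinate n + 1. *)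
Definition op_ss (e : edge G) :=
  weighted_shift (fun n => lss K ((e, n + 1) : edge G')) 1.

Lemma weighted_shiftM c d c' d' : weighted_shift c d ** weighted_shift c' d' =
  weighted_shift (fun n => c n ** c' (n + d)) (d + d').
Proof. by apply: lendoP => f; apply/funext => n /=; rewrite -nmulA addrA. Qed.

Lemma weighted_shift_ext c c' d : c =1 c' -> weighted_shift c d = weighted_shift c' d.
Proof. by move=> /funext->. Qed.

Lemma weighted_shift0 d : weighted_shift (fun=> 0) d = 0.
Proof. by apply: lendoP => f; apply/funext => n; exact: nmul0r. Qed.

Lemma weighted_shift_sum I (s : seq I) (c : I -> int -> L') d :
  \sum_(i <- s) weighted_shift (c i) d = weighted_shift (fun n => \sum_(i <- s) c i n) d.
Proof.
apply: lendoP => f; apply/funext => n /=; rewrite nmul_suml.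
elim: s => [|i s IH]; first by rewrite !big_nil.
by rewrite !big_cons -IH.
Qed.

Lemma level_rep : exists2 rho : L -> lendo V, nalg_hom rho &
  [/\ forall A, rho (lp K A) = op_p A, forall e, rho (ls K e) = op_s e
    & forall e, rho (lss K e) = op_ss e].
Proof.
apply: (@leavitt_universal _ _ _ op_p op_s op_ss) =>
  [|A B|A B|e|e|e|e|e f|v rv].
- by rewrite -(weighted_shift0 0); apply: weighted_shift_ext => n; rewrite level0 lp0.
- rewrite weighted_shiftM addr0; apply: weighted_shift_ext => n.
  by rewrite /= addr0 lpM levelI.
- apply: lendoP => h; apply/funext => n.
  rewrite -[RHS]/(op_p A h n + op_p B h n - op_p (gvtxI A B) h n) /=.
  by rewrite levelU lpU levelI !nmulDl nmulNr.
- rewrite weighted_shiftM add0r; apply: weighted_shift_ext => n.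
  by rewrite addr0 level1; exact: (@lp_ls K G' (e, n)).
- rewrite weighted_shiftM addr0; apply: weighted_shift_ext => n.
  by rewrite levelr; exact: (@ls_lp K G' (e, n)).
- rewrite weighted_shiftM add0r; apply: weighted_shift_ext => n.
  by rewrite addr0 -{1}(addrK 1 n) levelr; exact: (@lp_lss K G' (e, n + 1)).
- rewrite weighted_shiftM addr0; apply: weighted_shift_ext => n.
  by rewrite level1; exact: (@lss_lp K G' (e, n + 1)).
(* The weight at n pairs the adjoint for e_(n+1) with the generator for f_(n+1): the levels always
   agree, and only e and f have to be compared. *)
- rewrite weighted_shiftM subrr; case: eqP => [<-|ef].
    apply: weighted_shift_ext => n.
    by rewrite lss_ls eqxx -levelr addrK.
  rewrite -(weighted_shift0 0); apply: weighted_shift_ext => n.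
  by rewrite lss_ls; case: eqP => // -[].
- under eq_bigr do rewrite weighted_shiftM addNr.
  rewrite weighted_shift_sum; apply: weighted_shift_ext => n.
  rewrite level1 lp_reg ?sum_skew_fiber //; last exact/regular_skew.
  by apply: eq_bigr => e _; rewrite subrK.
Qed.

(** * Injectivity, by letting the smash product act on sequences *)

Section Injective.
Variable rho : L -> lendo V.
Hypothesis rho_hom : nalg_hom rho.
Hypothesis rho_p : forall A, rho (lp K A) = op_p A.
Hypothesis rho_s : forall e, rho (ls K e) = op_s e.
Hypothesis rho_ss : forall e, rho (lss K e) = op_ss e.

Lemma level_proj_shift k c d :
  level_proj k ** weighted_shift c d = weighted_shift c d ** level_proj (k + d).
Proof.
apply: lendoP => f; apply/funext => n /=.
by rewrite (inj_eq (addIr d)); case: ifP; rewrite ?nmulr0.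
Qed.

(** A generator of degree d acts as a weighted shift by -d, which moves the projections by d; shifts
    add under products as degrees do. *)
Lemma level_proj_homog d x : homog d x ->
  forall k, level_proj k ** rho x = rho x ** level_proj (k - d).
Proof.
move: d x; apply: leavitt_graded_ind => [A|e|e|n|n x y Px Py|n c x Px|m n x y _ _ Px Py] k.
- by rewrite rho_p level_proj_shift subr0 ?addr0.
- by rewrite rho_s level_proj_shift.
- by rewrite rho_ss level_proj_shift opprK.
- by rewrite (nalg_hom0 rho_hom) nmul0r nmulr0.
- by rewrite (nalg_homD rho_hom) nmulDl nmulDr Px Py.
- by rewrite (nalg_homZ rho_hom) nmulZl nmulZr Px.
- by rewrite (nalg_homM rho_hom) [LHS]nmulA Px -[LHS]nmulA Py [LHS]nmulA opprD addrA.
Qed.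

Lemma level_projM k n : level_proj k ** level_proj n = if k == n then level_proj n else 0.
Proof.
case: (eqVneq k n) => [->|kn]; apply: lendoP => f; apply/funext => m /=.
  by case: eqP.
by case: eqP => // ->; rewrite (negbTE kn).
Qed.

(** Between the projections to k and n only the component of degree k - n survives. This is the
    compatibility that extends [rho] to the smash product. *)
Lemma level_proj_rho k n x :
  level_proj k ** rho x ** level_proj n = rho (hcomp (k - n) x) ** level_proj n.
Proof.
(* The degree k - n is added to the support so that its term can be split off even when that
   component is 0. *)
have xE := @hcomp_sum _ _ x (undup (k - n :: hsupp x)) (undup_uniq _).
rewrite [in LHS]xE; last by move=> i ix; rewrite mem_undup inE ix orbT.
rewrite (nalg_hom_sum rho_hom) nmul_sumr nmul_suml.
under eq_bigr => i _.
  rewrite (level_proj_homog (hcomp_hom i x)) -nmulA level_projM.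
  rewrite subr_eq addrC -subr_eq.
  over.
rewrite (bigD1_seq (k - n)) ?undup_uniq ?mem_undup ?mem_head //= eqxx.
by rewrite big1 ?addr0 // => i ik; rewrite eq_sym (negbTE ik) nmulr0.
Qed.

Let Theta := smash_map rho level_proj.

(* The entries of f need not themselves lie in their level, nor have finite
   support: a constant sequence f = y is allowed. *)
Definition level_parts (f : V) (y : L') :=
  forall A n, lp K (level A n) ** y = lp K (level A n) ** f n.

Variable f : L' -> S.
Hypothesis fh : nalg_hom f.
Hypothesis fp : forall A, f (lp K A) = smash_p A.
Hypothesis fs : forall e, f (ls K e) = smash_s e.
Hypothesis fss : forall e, f (lss K e) = smash_ss e.

Lemma Theta_hom : nalg_hom Theta.
Proof. exact: smash_map_hom level_proj_rho. Qed.

(** At coordinate n the projections discard every term of the formal sum except the one with p_n. *)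
Lemma Theta_p B g n : Theta (smash_p B) g n = lp K (level (slice B n) n) ** g n.
Proof.
have [s _ Bs] := smash_supp (smash_p B); pose t := undup (n :: s).
have Bt k : smash_p B k != 0 -> k \in t by move=> /Bs ks; rewrite mem_undup inE ks orbT.
have sumE (F : int -> V) : (\sum_(i <- t) F i) n = \sum_(i <- t) F i n.
  by elim: (t) => [|i u IH]; rewrite ?big_nil // !big_cons -IH.
rewrite /Theta (smash_mapE _ rho_hom (undup_uniq _) Bt) lendo_sumE sumE.
under eq_bigr => k _ do rewrite rho_p /= addr0.
rewrite (bigD1_seq n) ?undup_uniq ?mem_undup ?mem_head //= eqxx big1 ?addr0 //.
by move=> k kn; rewrite eq_sym (negbTE kn) nmulr0.
Qed.

Lemma Theta_s e g n :
  Theta (smash_s e) g n = if n == e.2 then ls K e ** g (n - 1) else 0.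
Proof.
case: e => e m; rewrite /Theta (smash_map_term _ rho_hom) rho_s /=.
by rewrite (inj_eq (addIr _)); case: eqP => [->|_]; rewrite ?nmulr0.
Qed.

Lemma Theta_ss e g n :
  Theta (smash_ss e) g n = if n + 1 == e.2 then lss K e ** g (n + 1) else 0.
Proof.
case: e => e m; rewrite /Theta (smash_map_term _ rho_hom) rho_ss /=.
by case: eqP => [->|_]; rewrite ?nmulr0.
Qed.

(** An edge of index m has its source on level m and its range on level m - 1, so vertex sets on
    other levels annihilate its generator, respectively its adjoint. These are the coordinates where
    [Theta] gives 0. *)
Lemma lp_level_ls A n (e : edge G') : n != e.2 -> lp K (level A n) ** ls K e = 0.
Proof.
move=> ne; rewrite lp1_ls; case: ifP => // /set_mem.
by case: e ne => e m ne /levelE[_ mn]; rewrite mn eqxx in ne.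
Qed.

Lemma lp_level_lss A n (e : edge G') : n + 1 != e.2 -> lp K (level A n) ** lss K e = 0.
Proof.
case: e => e m /=; rewrite eq_sym -subr_eq eq_sym => ne.
rewrite -lp_lss -levelr nmulA lpM gvtxI_level slice_level ifN //.
  rewrite (_ : gvtxI A gvtx0 = gvtx0) ?level0 ?lp0 ?nmul0r //.
  by apply: gvtxP; rewrite /= setI0.
Qed.

(** Both sides are linear in x, and a product acts one factor after the other, with g and y varying;
    hence generators suffice. Each of them reads y on one level only for a given output level, where
    y may be replaced by an entry of g. *)
Lemma level_parts_act x g y : level_parts g y -> level_parts (Theta (f x) g) (x ** y).
Proof.
elim/leavitt_ind: x g y => [B|e|e||x x' IH IH'|c x IH|x x' IH IH'] g y gy A n.
- by rewrite fp Theta_p !nmulA !lpM !gvtxI_level slice_level eqxx; exact: gy.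
- rewrite fs Theta_s; case: eqP => [->|/eqP ne]; last first.
    by rewrite nmulA lp_level_ls // nmul0r nmulr0.
  congr (_ ** _); case: e => e m /=.
  (* Inserting the range projection on level m - 1 exposes the part of y that agrees with
     [g (m - 1)]. *)
  by rewrite -ls_lp -levelr -!nmulA gy.
- rewrite fss Theta_ss; case: eqP => [ne|/eqP ne]; last first.
    by rewrite nmulA lp_level_lss // nmul0r nmulr0.
  congr (_ ** _); case: e ne => e m /= ->.
  (* The source projection lies on level m = n + 1, where y agrees with [g m]. *)
  by rewrite -lss_lp -!nmulA /= -level1 gy.
- by rewrite nmul0r (nalg_hom0 fh) (nalg_hom0 Theta_hom) !nmulr0.
- rewrite nmulDl (nalg_homD fh) (nalg_homD Theta_hom) nmulDr (IH _ _ gy) (IH' _ _ gy).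
  by rewrite -nmulDr.
- rewrite nmulZl (nalg_homZ fh) (nalg_homZ Theta_hom) nmulZr (IH _ _ gy).
  by rewrite -nmulZr.
- rewrite -nmulA (nalg_homM fh) (nalg_homM Theta_hom) lendoME; exact/IH/IH'.
Qed.

(** Some p_B fixes x from the left. Singletons and ranges of the skew product are single levels, so
    p_B x = 0 for these, and unions and intersections follow from relation (1). *)
Lemma lp_level_eq0 (x : L') : (forall (A : gvtx G) n, lp K (level A n) ** x = 0) -> x = 0.
Proof.
move=> x0; have [[B Bg] <-] := leavitt_left_unit x; move: (Bg).
elim: B / Bg => [|[v n]|[e n]|A B Ag IHA Bg IHB|A B Ag IHA Bg IHB] ABg.
- by rewrite (_ : exist _ _ _ = gvtx0) ?lp0 ?nmul0r //; exact: gvtxP.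
- rewrite -(x0 (gvtx1 v) n) level1; congr (lp K _ ** _); exact: gvtxP.
- rewrite -(x0 (gvtxr e) (n - 1)) levelr; congr (lp K _ ** _); exact: gvtxP.
- rewrite (_ : exist _ _ _ = gvtxU (exist _ A Ag) (exist _ B Bg)); last exact: gvtxP.
  by rewrite lpU -lpM !nmulDl nmulNr -nmulA IHA IHB nmulr0 subr0 addr0.
- rewrite (_ : exist _ _ _ = gvtxI (exist _ A Ag) (exist _ B Bg)); last exact: gvtxP.
  by rewrite -lpM -nmulA IHB nmulr0.
Qed.

Lemma skew_to_smash_inj x : f x = 0 -> x = 0.
Proof.
move=> fx0; have [B <-] := leavitt_unit x; apply: lp_level_eq0 => A n.
(* With x p_B = x, the constant sequence p_B trivially has the level parts of p_B; acting on it by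
   f(x) = 0 shows that x p_B vanishes on every level. *)
have := @level_parts_act x (fun=> lp K B) (lp K B) (fun _ _ => erefl) A n.
by rewrite fx0 (nalg_hom0 Theta_hom) nmulr0.
Qed.
End Injective.
End Isomorphism.

Theorem theorem4p8 (K : fieldType) (G : ultragraph)
    (no_sink : forall v : vtx G, ~ sink v) :
  exists f : leavitt K (skew_product G) -> smash (leavitt K G), graded_iso f.
Proof.
have [f fh [fp fs fss]] := @skew_to_smash K G.
have [rho rho_hom [rho_p rho_s rho_ss]] := @level_rep K G.
exists f; apply: graded_iso_of_hom => //.
- exact: (skew_to_smash_inj rho_hom).
- exact: skew_to_smash_surj.
- exact: skew_to_smash_homog.
Qed.
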